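(* Let $p\in(1,\infty)$, $M\ge1$, let $Y\subset\mathbb{R}^N$ be a periodicity cell, $\Omega=Y$, and $\varepsilon_n=\frac1n$ for $n\in\mathbb{N}\setminus\{0\}$. Let $V:\mathbb{R}^N\times\mathbb{R}^M\to\mathbb{R}$ be a Carathéodory function such that $x\mapsto V(x,z)$ is $Y$-periodic for each $z\in\mathbb{R}^M$, and such that there are constants $0<c_1<c_2<+\infty$ with $$c_1(|z|^p-1)\le V(x,z)\le c_2(|z|^p+1)$$ for all $x$ and all $z\in\mathbb{R}^M$. Assume that for all $y\in Y$ the function $u\mapsto V(y,u)$ is strictly convex. Let $m\in\mathbb{R}^M$. Then $$\min\Big\{G_n(v): v\in L^p(\Omega;\mathbb{R}^M),\ \int_\Omega v(x)\,dx=m\Big\}=\min\Big\{G_{\rm hom}(v): v\in L^p(\Omega;\mathbb{R}^M),\ \int_\Omega v(x)\,dx=m\Big\}$$ for all $n\in\mathbb{N}\setminus\{0\}$.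
   Context: Periodicity cell: for a basis $v_1,\dots,v_N$ of $\mathbb{R}^N$, $Y$ is the open parallelepiped spanned by $v_1,\dots,v_N$, translated so that its barycenter is the origin, i.e. $Y=\{\sum_i\lambda_iv_i: -\frac12<\lambda_i<\frac12\}$. $Y$-periodic means invariant under translation by each $v_i$. Carathéodory: measurable in the first variable and continuous in the second. $G_n(u)=\int_\Omega V\big(\frac{x}{\varepsilon_n},u(x)\big)\,dx$ for $u\in L^p(\Omega;\mathbb{R}^M)$. $V^c$ denotes the convex envelope of $V$ in the second variable, and for $z\in\mathbb{R}^M$ $$V_{\rm hom}(z)=\inf\Big\{\frac1{|Y|}\int_Y V^c(y,z+\varphi(y))\,dy:\ \varphi\in L^p(Y;\mathbb{R}^M),\ \int_Y\varphi(y)\,dy=0\Big\}.$$ $G_{\rm hom}(u)=\int_\Omega V_{\rm hom}(u(x))\,dx$ for $u\in L^p(\Omega;\mathbb{R}^M)$. *)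

(* Defs.v *)
From HB Require Import structures.
From mathcomp Require Import all_boot all_order all_algebra.
From mathcomp Require Import all_classical all_reals all_analysis.

Set Implicit Arguments.
Unset Strict Implicit.
Unset Printing Implicit Defensive.

Import Order.TTheory GRing.Theory Num.Theory.
Import numFieldNormedType.Exports.

Local Open Scope classical_set_scope.
Local Open Scope ring_scope.

(* MathComp-Analysis has no Lebesgue measure on R^n for n > 1. It is built here
   in the textbook way: the outer measure given by countable covers by
   half-open boxes, restricted to the Caratheodory-measurable (that is, Lebesgue
   measurable) sets. The dimension is n.+1 because in dimension 0 the empty set
   would not be covered by boxes of volume 0. *)
Section lebesgue_rV.
Context (R : realType) (n : nat).
Local Open Scope ereal_scope.
Local Notation rV := 'rV[R]_n.+1.
Implicit Types (a b : rV) (A : set rV) (F : nat -> rV * rV).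

Definition box a b : set rV := [set x | forall i, (a 0 i < x 0 i <= b 0 i)%R].

Definition box_volume a b : R := (\prod_i Num.max 0 (b 0 i - a 0 i))%R.

Definition box_cover A : set (nat -> rV * rV) :=
  [set F | A `<=` \bigcup_k box (F k).1 (F k).2].

Definition lebesgue_outer A : \bar R :=
  ereal_inf [set \sum_(k <oo) (box_volume (F k).1 (F k).2)%:E
            | F in box_cover A].

Let vol_ge0 (p : rV * rV) : 0 <= (box_volume p.1 p.2)%:E.
Proof. by rewrite lee_fin; apply: prodr_ge0 => i _; rewrite le_max lexx. Qed.

Let lebesgue_outer_ge0 A : 0 <= lebesgue_outer A.
Proof. by apply: le_ereal_inf_tmp => _ [F _ <-]; exact: nneseries_ge0. Qed.

Let lebesgue_outer0 : lebesgue_outer set0 = 0.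
Proof.
apply/eqP; rewrite eq_le lebesgue_outer_ge0 andbT.
apply: ereal_inf_lbound; exists (fun=> (0%R, 0%R)); first exact: sub0set.
apply: eseries0 => k _ _ /=; congr EFin.
by rewrite /box_volume (bigD1 ord0)//= subrr maxxx mul0r.
Qed.

Let le_lebesgue_outer : {homo lebesgue_outer : A B / A `<=` B >-> A <= B}.
Proof.
move=> A B AB; apply/ereal_inf_le_tmp => _ [F BF <-].
by exists F => //; exact: subset_trans BF.
Qed.

Let lebesgue_outer_sigma_subadditive : sigma_subadditive lebesgue_outer.
Proof.
move=> A; have [[i ioo]|] := pselect (exists i, lebesgue_outer (A i) = +oo).
  by rewrite (eseries_pinfty _ _ ioo) ?leey// => k _;
     rewrite -ltNye (lt_le_trans _ (lebesgue_outer_ge0 _)).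
rewrite -forallNE => Aoo; apply/lee_addgt0Pr => e e0.
rewrite (le_trans _ (epsilon_trick _ _ (ltW e0)))//.
pose P k F := box_cover (A k) F /\
  \sum_(j <oo) (box_volume (F j).1 (F j).2)%:E
    <= lebesgue_outer (A k) + (e / (2 ^ k.+1)%:R)%:E.
have [G PG] : {G : nat -> nat -> rV * rV & forall k, P k (G k)}.
  apply: (@choice _ _ P) => k.
  have fA : lebesgue_outer (A k) \is a fin_num.
    by rewrite ge0_fin_numE// ltey; apply/eqP/Aoo.
  have ek : (0 < e / (2 ^ k.+1)%:R)%R by rewrite divr_gt0// ltr0n expn_gt0.
  have [_ [F cF <-] lF] := lb_ereal_inf_adherent ek fA.
  by exists F; split=> //; exact: ltW.
pose w (i : nat * nat) := (box_volume (G i.1 i.2).1 (G i.1 i.2).2)%:E.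
have w0 i : 0 <= w i by exact: vol_ge0.
apply: (@le_trans _ _ (\esum_(i in setT) w i)).
  have /card_esym/ppcard_eqP[f] := card_nat2.
  apply: ereal_inf_lbound; exists (fun k => G (f k).1 (f k).2).
    move=> x [k _ /(PG k).1[j _ xkj]].
    by exists (f^-1%FUN (k, j)) => //; rewrite invK ?inE.
  rewrite -(esum_pred_image w f xpredT) ?[fun=> _]set_true//.
  by rewrite image_eq.
rewrite (_ : esum _ _ = \sum_(i <oo) \sum_(j <oo) w (i, j)); last first.
  pose J k : set (nat * nat) := [set (k, j) | j in setT].
  rewrite (_ : setT = \bigcup_k J k); last first.
    by rewrite predeqE => -[k j]; split => // _; exists k => //; exists j.
  rewrite esum_bigcupT//=; last first.
    apply/trivIsetP => i j _ _ ij.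
    rewrite predeqE => -[k m] /=; split => //= -[] [_] _ [<-{k} _].
    by move=> [m' _] [] /esym/eqP; rewrite (negbTE ij).
  rewrite -(image_id [set: nat]) -fun_true esum_pred_image//; last first.
    by move=> k _; exact: esum_ge0.
  apply: eq_eseriesr => k _.
  rewrite -(esum_pred_image w (pair k) predT)//=; last first.
    by move=> ? ? _ _; exact: (@can_inj _ _ _ snd).
  by congr esum; rewrite predeqE => -[a b]; split; move=> [i _ <-]; exists i.
apply: lee_nneseries => k *; last exact: (PG k).2.
by apply: nneseries_ge0 => j *; exact: w0.
Qed.

HB.instance Definition _ := isOuterMeasure.Build R rV lebesgue_outer
  lebesgue_outer0 lebesgue_outer_ge0 le_lebesgue_outer
  lebesgue_outer_sigma_subadditive.

Definition lebesgue_rV : set (caratheodory_type lebesgue_outer) -> \bar R :=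
  lebesgue_outer.

Let lebesgue_rV0 : lebesgue_rV set0 = 0.
Proof. exact: outer_measure0. Qed.

Let lebesgue_rV_ge0 A : 0 <= lebesgue_rV A.
Proof. exact: outer_measure_ge0. Qed.

Let lebesgue_rV_semi_sigma_additive : semi_sigma_additive lebesgue_rV.
Proof. exact: caratheodory_measure_sigma_additive. Qed.

HB.instance Definition _ := isMeasure.Build _ _ _ lebesgue_rV
  lebesgue_rV0 lebesgue_rV_ge0 lebesgue_rV_semi_sigma_additive.

End lebesgue_rV.
Arguments lebesgue_rV {R n}.

(* R^n.+1 with the sigma-algebra of Lebesgue-measurable sets. *)
Notation lebesgue_type R n := (caratheodory_type (@lebesgue_outer R n)).

Definition eucl_norm (R : realType) (m : nat) (z : 'rV[R]_m) : R :=
  Num.sqrt (\sum_i z 0 i ^+ 2).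

Section vector_valued.
Context (R : realType) (n m : nat).
Implicit Types (Omega : set (lebesgue_type R n)).
Implicit Types (u : lebesgue_type R n -> 'rV[R]_m).

(* L^p(Omega; R^m), through representatives; only the values on Omega matter. *)
Definition Lp (p : R) Omega : set (lebesgue_type R n -> 'rV[R]_m) :=
  [set u : lebesgue_type R n -> 'rV[R]_m |
     (forall i, measurable_fun Omega (fun x => u x 0 i)) /\
     (\int[lebesgue_rV]_(x in Omega) (eucl_norm (u x) `^ p)%:E < +oo)%E].

Definition vintegral Omega u : 'rV[R]_m :=
  \row_i \int[lebesgue_rV]_(x in Omega) u x 0 i.

End vector_valued.
Arguments Lp {R n} m p Omega.

Section periodicity.
Context (R : realType) (n m : nat).
Implicit Types (v : n.-tuple 'rV[R]_n) (V : 'rV[R]_n -> 'rV[R]_m -> R).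

(* The vectors v are assumed to form a basis where this is used. *)
Definition periodicity_cell v : set 'rV[R]_n :=
  [set \sum_i lambda i *: tnth v i | lambda in
     [set lambda : 'I_n -> R | forall i, - 2^-1 < lambda i < 2^-1]].

Definition cell_periodic v V := forall z i x, V (x + tnth v i) z = V x z.

End periodicity.

Definition caratheodory_function (R : realType) (n m : nat)
    (V : 'rV[R]_n.+1 -> 'rV[R]_m -> R) :=
  (forall z, measurable_fun [set: lebesgue_type R n] (V ^~ z)) /\
  (forall x, continuous (V x)).

Section convexity.
Context (R : realType) (m : nat).
Implicit Types f g : 'rV[R]_m -> R.

Definition strictly_convex f := forall x y (t : R),
  x != y -> 0 < t < 1 ->
  f (t *: x + (1 - t) *: y) < t * f x + (1 - t) * f y.

(* The greatest convex function below f; extended-valued so that the supremum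
   needs no side condition. *)
Definition convex_envelope f (z : 'rV[R]_m) : \bar R :=
  ereal_sup [set (g z)%:E | g in
    [set g | convex_function [set: 'rV[R]_m] g /\ forall w, g w <= f w]].

End convexity.

(* The energies are extended-valued, so that neither integrability nor
   boundedness of the infimum is presupposed by the definitions. *)
Section energies.
Context (R : realType) (n m : nat).
Variable (V : 'rV[R]_n.+1 -> 'rV[R]_m -> R).
Local Open Scope ereal_scope.

Definition G_eps (Omega : set (lebesgue_type R n)) (eps : R)
    (u : lebesgue_type R n -> 'rV[R]_m) : \bar R :=
  \int[lebesgue_rV]_(x in Omega)
    (V (eps^-1 *: (x : 'rV[R]_n.+1))%R (u x))%:E.

Definition V_hom (p : R) (Y : set (lebesgue_type R n)) (z : 'rV[R]_m) :
    \bar R :=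
  ereal_inf [set (fine (lebesgue_rV Y))^-1%:E *
      \int[lebesgue_rV]_(y in Y) convex_envelope (V y) (z + phi y)%R
    | phi in [set phi | Lp m p Y phi /\ vintegral Y phi = 0%R]].

Definition G_hom (p : R) (Y Omega : set (lebesgue_type R n))
    (u : lebesgue_type R n -> 'rV[R]_m) : \bar R :=
  \int[lebesgue_rV]_(x in Omega) V_hom p Y (u x).

End energies.

Definition is_min_on (T : Type) (R : realType) (A : set T) (f : T -> \bar R)
    (c : \bar R) :=
  (exists2 u, A u & f u = c) /\ (forall u, A u -> (c <= f u)%E).

(* Main.v *)
(** For each multiplier [xi], strict convexity and coercivity give a unique
minimiser [w xi y] of [z |-> V y z - <xi, z>]; it is bounded uniformly in [y],
measurable in [y] and continuous in [xi]. The dual function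
[xi |-> \int_Y (<xi, w xi y> - V y (w xi y)) - <xi, m>] is finite, continuous and
coercive on R^M, so it has a minimiser [xi], and stationarity there says exactly
that [w xi] has integral [m]. Hence
[V y z >= V y (w xi y) + <xi, z - w xi y>] on [Y] with equality at [z = w xi y].
Integrating this inequality shows that the periodic extension of [w xi], rescaled
by [n], minimises [G_n], because [x |-> n x] modulo the lattice preserves Lebesgue
measure on [Y]. It also bounds [V_hom] from below by an affine function that is
attained at [m / |Y|], so the constant [m / |Y|] minimises [G_hom]; both minima
equal [\int_Y V y (w xi y)]. No measurability of [V_hom] is needed, since the
integral is monotone on arbitrary functions. *)

Require Import Defs.
From HB Require Import structures.
From mathcomp Require Import all_boot all_order all_algebra.
From mathcomp Require Import all_classical all_reals all_analysis.
From mathcomp Require Import measurable_realfun.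
From mathcomp Require Import ring lra.

Set Implicit Arguments.
Unset Strict Implicit.

Import Order.TTheory GRing.Theory Num.Theory.
Import numFieldNormedType.Exports.

Local Open Scope classical_set_scope.
Local Open Scope ring_scope.

(** * Lebesgue measure on R^n under affine maps *)

(** Uniqueness of [w xi y] is upgraded, by compactness of sublevel sets, to well-posedness: almost
    minimal points lie close to the minimiser. This one property yields both the continuity of [w]
    in [xi] and, by testing rational points, its measurability in [y]. It also makes the natural
    subgradient of the dual function continuous, so stationarity follows from difference bounds in
    the coordinate directions, without differentiating under the integral.

    Strict convexity is assumed only on the open cell, whose lattice translates leave a null set
    uncovered. Reduction of [n x] modulo the lattice is therefore encoded by a map [T] that leaves
    the cell on a null set; functions are extended by zero there, and pointwise relations for [G_n]
    hold almost everywhere. That [T] preserves measure comes from translations and dilations alone,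
    by cutting cells into pieces and reassembling them. *)

Lemma measurable_fun_ltP d (T : measurableType d) (R : realType) (D : set T)
    (f : T -> R) :
  (forall c, measurable (D `&` [set x | f x < c])) -> measurable_fun D f.
Proof.
move=> mf; apply: (measurability _ (RGenInftyO.measurableE R)).
move=> _ [_ [c ->] <-]; rewrite (_ : f @^-1` _ = [set x | f x < c])//.
Qed.

Section outer.
Context {R : realType} {n : nat}.
Local Notation rV := 'rV[R]_n.+1.
Local Notation mu := (@lebesgue_outer R n).
Local Notation E := (lebesgue_type R n).

Lemma box_volume_ge0 (a b : rV) : 0 <= box_volume a b.
Proof. by apply: prodr_ge0 => i _; rewrite le_max lexx. Qed.

Lemma lebesgue_outer_le_cover {A : set rV} {F} : box_cover A F ->
  (mu A <= \sum_(k <oo) (box_volume (F k).1 (F k).2)%:E)%E.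
Proof. by move=> AF; apply: ereal_inf_lbound; exists F. Qed.

Definition set_coord (a : rV) i (c : R) : rV :=
  \row_j (if j == i then c else a 0 j).

(** The hyperplane where coordinate [i] equals [c] cuts the box in two. The truncations keep the
    identity true when the hyperplane misses the box or the box is empty. *)
Lemma box_volume_split (a b : rV) i (c : R) :
  box_volume a b = box_volume a (set_coord b i (Num.min (b 0 i) c)) +
                   box_volume (set_coord a i (Num.max (a 0 i) c)) b.
Proof.
rewrite /box_volume /set_coord (bigD1 i)//= [in RHS](bigD1 i)//=.
rewrite [X in _ = _ + X](bigD1 i)//= !mxE !eqxx.
rewrite [in RHS](eq_bigr (fun j => Num.max 0 (b 0 j - a 0 j))); last first.
  by move=> j /negPf ji; rewrite !mxE ?ji.
rewrite [X in _ = _ + _ * X](eq_bigr (fun j => Num.max 0 (b 0 j - a 0 j))); last first.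
  by move=> j /negPf ji; rewrite !mxE ?ji.
rewrite -mulrDl; congr (_ * _).
rewrite /Num.max /Num.min; do !case: ifP; rewrite ?ltNge; lra.
Qed.

(** Any cover of a test set [X] is cut along the hyperplane into covers of the two parts of [X]. By
    [box_volume_split] the total volume is unchanged, which is the Caratheodory inequality. *)
Lemma measurable_halfspace i (c : R) :
  measurable ([set x : rV | x 0 i <= c] : set E).
Proof.
apply: le_caratheodory_measurable => X.
apply: le_ereal_inf_tmp => _ [F XF <-].
pose F1 k := ((F k).1, set_coord (F k).2 i (Num.min ((F k).2 0 i) c)).
pose F2 k := (set_coord (F k).1 i (Num.max ((F k).1 0 i) c), (F k).2).
have XF1 : box_cover (X `&` [set x | x 0 i <= c]) F1.
  move=> x [/XF[k _ xk] xic]; exists k => // j /=; have /andP[-> /=] := xk j.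
  by rewrite mxE; case: eqP => // ->; rewrite le_min => ->.
have XF2 : box_cover (X `&` ~` [set x | x 0 i <= c]) F2.
  move=> x [/XF[k _ xk] /negP xic]; exists k => // j /=; have /andP[+ ->] := xk j.
  by rewrite mxE andbT; case: eqP => // ->; rewrite gt_max => ->; rewrite real_ltNge ?num_real.
apply: (le_trans (leeD (lebesgue_outer_le_cover XF1) (lebesgue_outer_le_cover XF2))).
rewrite -nneseriesD; [|by move=> *; rewrite lee_fin box_volume_ge0..].
apply: lee_nneseries => [k _ _|k _]; last by rewrite -EFinD lee_fin -box_volume_split.
by rewrite adde_ge0// lee_fin box_volume_ge0.
Qed.

Lemma measurable_coord (i : 'I_n.+1) :
  measurable_fun [set: E] (fun x : E => (x : rV) 0 i).
Proof.
apply: (measurability _ (RGenOInfty.measurableE R)).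
move=> _ [_ [c ->] <-]; rewrite setTI.
rewrite (_ : _ @^-1` _ = ~` [set x : E | (x : rV) 0 i <= c]).
  exact/measurableC/measurable_halfspace.
by apply/seteqP; split=> x /=; rewrite in_itv/= andbT real_ltNge ?num_real// => /negP.
Qed.

(** A cover of [A] is transported by the inverse map. Positivity of [s] keeps the open and closed
    sides of the half-open boxes in place. *)
Lemma lebesgue_outer_affine_le (s : R) (t : rV) (A : set rV) : 0 < s ->
  (mu [set x | A (s *: x + t)%R] <= (s ^-1 ^+ n.+1)%:E * mu A)%E.
Proof.
move=> s0; have sn0 : 0 < s ^-1 ^+ n.+1 by rewrite exprn_gt0// invr_gt0.
rewrite -lee_pdivrMl//; apply: le_ereal_inf_tmp => _ [F AF <-].
rewrite lee_pdivrMl//.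
pose G k := (s^-1 *: ((F k).1 - t), s^-1 *: ((F k).2 - t)).
have AG : box_cover [set x | A (s *: x + t)] G.
  move=> x /AF[k _ xk]; exists k => // i; have := xk i; rewrite !mxE.
  by rewrite -ltrBlDr -lerBrDr ![s^-1 * _]mulrC ltr_pdivrMr// ler_pdivlMr// mulrC.
apply: (le_trans (lebesgue_outer_le_cover AG)).
rewrite -nneseriesZl//; last by move=> k _; rewrite lee_fin box_volume_ge0.
apply: lee_nneseries => [k _ _|k _]; first by rewrite lee_fin box_volume_ge0.
rewrite -EFinM lee_fin /box_volume.
have -> : s^-1 ^+ n.+1 = \prod_(i < n.+1) s^-1 by rewrite prodr_const card_ord.
rewrite -big_split/=.
rewrite le_eqVlt; apply/orP; left; apply/eqP; apply: eq_bigr => i _.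
by rewrite !mxE -mulrBr maxr_pMr ?invr_ge0 ?ltW// mulr0; congr (Num.max _ (_ * _)); ring.
Qed.

Lemma affine_rK (s : R) (t x : rV) : 0 < s ->
  s *: (s^-1 *: x + - s^-1 *: t) + t = x.
Proof.
by move=> s0; rewrite scalerDr !scalerA mulrN mulfV ?gt_eqF// scale1r scaleN1r subrK.
Qed.

Lemma affineK (s : R) (t x : rV) : 0 < s ->
  s^-1 *: (s *: x + t) + - s^-1 *: t = x.
Proof.
by move=> s0; rewrite scalerDr !scalerA mulVf ?gt_eqF// scale1r scaleNr addrK.
Qed.

Lemma lebesgue_outer_affine (s : R) (t : rV) (A : set rV) : 0 < s ->
  mu [set x | A (s *: x + t)%R] = ((s ^-1 ^+ n.+1)%:E * mu A)%E.
Proof.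
move=> s0; apply/eqP; rewrite eq_le lebesgue_outer_affine_le//=.
(* The reverse inequality is the same bound for the inverse affine map. *)
have := @lebesgue_outer_affine_le s^-1 (- s^-1 *: t) [set x | A (s *: x + t)%R].
rewrite invr_gt0 => /(_ s0).
have -> : [set x | [set x | A (s *: x + t)] (s^-1 *: x + - s^-1 *: t)] = A.
  by apply/seteqP; split=> x /=; rewrite affine_rK.
have sn0 : 0 < s ^-1 ^+ n.+1 by rewrite exprn_gt0// invr_gt0.
by rewrite -[in X in _ -> X]lee_pdivlMl// invrK exprVn invrK.
Qed.

Lemma measurable_affine (s : R) (t : rV) (A : set E) : 0 < s -> measurable A ->
  measurable ([set x | A (s *: (x : rV) + t)%R] : set E).
Proof.
move=> s0 mA; have {}mA : caratheodory_measurable mu A by exact: mA.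
suff : caratheodory_measurable mu [set x | A (s *: (x : rV) + t)%R] by exact.
move=> X.
(* The test set is itself written as a preimage, so that all three terms of the Caratheodory
   identity scale by the same factor. *)
pose X' : set rV := [set x | X (s^-1 *: x + (- s^-1 *: t))].
have -> : X = [set x | X' (s *: x + t)].
  by apply/seteqP; split=> x /=; rewrite /X'/= affineK.
transitivity ((s ^-1 ^+ n.+1)%:E * (mu (X' `&` A) + mu (X' `&` ~` A)))%E.
  by rewrite -mA lebesgue_outer_affine.
rewrite ge0_muleDr ?outer_measure_ge0//.
by rewrite -!(lebesgue_outer_affine t _ s0).
Qed.

End outer.

(* Integrating the covering inequality against the first coordinate removes that
   coordinate, so the bound follows by induction on the dimension. *)
Lemma unit_cube_cover (R : realType) k (a b : nat -> 'I_k -> R) (c : nat -> R) :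
  (forall j, 0 <= c j) ->
  (forall x : 'I_k -> R, (forall i, 0 < x i <= 1) ->
    (1 <= \sum_(j <oo) (c j * \prod_i ((a j i < x i <= b j i)%R)%:R)%:E)%E) ->
  (1 <= \sum_(j <oo) (c j * \prod_i Num.max 0 (b j i - a j i))%:E)%E.
Proof.
elim: k a b c => [|k IH] a b c c0 H.
  apply: (le_trans (H (fun=> 1) _)); first by case.
  apply: lee_nneseries => j *; last by rewrite !big_ord0.
  by rewrite lee_fin big_ord0 mulr1.
(* The length of the first side joins the weight [c j]: the weights exist to make the induction
   close. *)
rewrite (eq_eseriesr (g := fun j => ((c j * Num.max 0 (b j ord0 - a j ord0)) *
    \prod_(i < k) Num.max 0 (b j (lift ord0 i) - a j (lift ord0 i)))%:E)); last first.
  by move=> j _; rewrite big_ord_recl mulrA.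
apply: (IH (fun j i => a j (lift ord0 i)) (fun j i => b j (lift ord0 i))) => [j|x x01].
  by rewrite mulr_ge0// le_max lexx.
pose c' j := c j * \prod_i ((a j (lift ord0 i) < x i <= b j (lift ord0 i))%R)%:R.
have c'0 j : 0 <= c' j by rewrite mulr_ge0// prodr_ge0.
pose I j : set R := `]a j ord0, b j ord0]%classic.
pose f j (t : R) : \bar R := ((c' j)%:E * (\1_(I j) t)%:E)%E.
have f0 j t : (0 <= f j t)%E by rewrite mule_ge0 ?lee_fin.
have mf j : measurable_fun [set: R] (f j).
  by apply: measurable_funeM; apply/measurable_EFinP; apply: measurable_indic;
    exact: measurable_itv.
have mD : measurable (`]0, 1]%classic : set R) by exact: measurable_itv.
apply: (@le_trans _ _ (\int[lebesgue_measure]_(t in `]0%R, 1%R]) (\sum_(j <oo) f j t))%E).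
  apply: (@le_trans _ _ (\int[@lebesgue_measure R]_(t in `]0%R, 1%R]) cst 1 t)%E).
    by rewrite integral_cst//= lebesgue_measure_itv/= lte_fin ltr01 sube0 mule1.
  apply: ge0_le_integral => //.
  - by apply: ge0_emeasurable_sum => // j _; exact: (measurable_funTS (mf j)).
  - move=> t; rewrite set_itvE/= => t01.
    pose y i := if unlift ord0 i is Some i' then x i' else t.
    apply: (le_trans (H y _)).
      by move=> i; rewrite /y; case: unliftP.
    apply: lee_nneseries => [j *|j _].
      by rewrite lee_fin mulr_ge0// prodr_ge0.
    rewrite big_ord_recl /f -EFinM lee_fin /y unlift_none indicE.
    under eq_bigr do rewrite liftK.
    rewrite mulrCA mulrC /c' mem_setE in_itv/=.
    by [].
rewrite integral_nneseries//; last by move=> j; exact: (measurable_funTS (mf j)).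
apply: lee_nneseries => [j *|j _]; first exact: integral_ge0.
rewrite ge0_integralZl_EFin//; last first.
  by apply: measurable_funTS; apply/measurable_EFinP; apply: measurable_indic;
    exact: measurable_itv.
rewrite integral_indic//; last exact: measurable_itv.
rewrite mulrAC -/(c' j) [leRHS]EFinM; apply: lee_wpmul2l; first by rewrite lee_fin.
apply: (@le_trans _ _ (lebesgue_measure (I j))).
  by apply: le_measure => //; rewrite ?inE; [apply: measurableI => //|]; exact: measurable_itv.
rewrite lebesgue_measure_itv/= lte_fin; case: ifPn => ab; last by rewrite lee_fin le_max lexx.
by rewrite -EFinB lee_fin le_max lexx orbT.
Qed.

(** * Nontriviality and local finiteness of the outer measure *)

Section outer_pos.
Context {R : realType} {n : nat}.
Local Notation rV := 'rV[R]_n.+1.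
Local Notation mu := (@lebesgue_outer R n).
Local Notation E := (lebesgue_type R n).

Lemma lebesgue_outer_unit_cube : (1 <= mu (box 0 (const_mx 1%R) : set rV))%E.
Proof.
apply: le_ereal_inf_tmp => _ [F cF <-].
rewrite (eq_eseriesr (g := fun j => (1 *
    \prod_i Num.max 0 ((F j).2 0 i - (F j).1 0 i))%:E)); last first.
  by move=> j _; rewrite mul1r.
apply: unit_cube_cover => // x x01.
have [|k _ xk] := cF (\row_i x i); first by move=> i; rewrite !mxE.
rewrite (nneseriesD1 (n := k))//=; last first.
  by move=> j _; rewrite lee_fin mul1r prodr_ge0.
rewrite mul1r big1 => [|i _]; last by have := xk i; rewrite mxE => ->.
by rewrite leeDl// nneseries_ge0// => j _ _; rewrite lee_fin mul1r prodr_ge0.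
Qed.

Lemma lebesgue_outer_box_lty a b : (mu (box a b) < +oo)%E.
Proof.
pose F k : rV * rV := if k is 0%N then (a, b) else (0, 0).
have cF : box_cover (box a b) F by move=> x xab; exists 0%N.
apply: (le_lt_trans (lebesgue_outer_le_cover cF)).
rewrite (nneseriesD1 (n := 0%N))//=; last by move=> j _; rewrite lee_fin box_volume_ge0.
rewrite eseries0 ?adde0 ?ltry// => -[|k]//= _ _.
by rewrite /box_volume (bigD1 ord0)//= subrr maxxx mul0r.
Qed.

End outer_pos.

(** * Lattice cells *)

(** A family indexed by a countable type becomes a sequence through [pickle_inv], with the empty set
    at non-codes. Two partitions indexed by the same lattice can then be compared term by term. *)
Lemma measure_partition d (T : measurableType d) (R : realType)
    (mu : {measure set T -> \bar R}) (I : countType) (F : I -> set T) (A : set T) :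
  measurable A -> (forall k, measurable (F k)) -> (forall x, exists k, F k x) ->
  (forall x k l, F k x -> F l x -> k = l) ->
  mu A = (\sum_(j <oo) mu (A `&` oapp F set0 (pickle_inv j)))%E.
Proof.
move=> mA mF cF dF; set G := fun j => A `&` oapp F set0 (pickle_inv j).
have mG j : measurable (G j).
  by rewrite /G; apply: measurableI => //; case: pickle_inv => /=.
rewrite -measure_semi_bigcup//.
- congr (mu _); apply/seteqP; split=> [x Ax|x [j _ []]//].
  by have [k Fx] := cF x; exists (pickle k) => //; split; rewrite ?pickleK_inv.
- apply/trivIsetP => i j _ _; apply: contraNeq => /set0P[x [[_ +] [_ ]]].
  case Ei: (pickle_inv i) => [k|//] /=; case Ej: (pickle_inv j) => [l|//] /= Fk Fl.
  have := @pickle_invK I i; have := @pickle_invK I j; rewrite Ei Ej /= => <- <-.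
  by rewrite (dF _ _ _ Fk Fl).
- exact: bigcupT_measurable.
Qed.

Section cell.
Context {R : realType} {n : nat} (P : 'M[R]_n.+1) (Pu : P \in unitmx).
Local Notation rV := 'rV[R]_n.+1.
Local Notation mu := (@lebesgue_rV R n).
Local Notation E := (lebesgue_type R n).

Definition cell_coord (x : rV) : rV := x *m invmx P.

Definition lattice_pt (k : 'rV[int]_n.+1) : rV := map_mx intr k *m P.

(** Half-open, so that the lattice translates tile the space exactly. The corner [0] suits
    dilations, the corner [- 2^-1] matches the centred cell. *)
Definition shifted_cell (s : R) : set E :=
  [set x | forall i, s <= cell_coord x 0 i < s + 1].

Definition lattice_periodic (B : set E) :=
  forall (x : rV) k, B (x + lattice_pt k) <-> B x.

Lemma cell_coordD x y : cell_coord (x + y) = cell_coord x + cell_coord y.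
Proof. exact: mulmxDl. Qed.

Lemma cell_coordZ c x : cell_coord (c *: x) = c *: cell_coord x.
Proof. by rewrite /cell_coord scalemxAl. Qed.

Lemma cell_coord_lattice k : cell_coord (lattice_pt k) = map_mx intr k.
Proof. exact: mulmxK. Qed.

Lemma cell_coord_addl x k i :
  cell_coord (x + lattice_pt k) 0 i = cell_coord x 0 i + (k 0 i)%:~R.
Proof.
by rewrite cell_coordD cell_coord_lattice [LHS]mxE [X in _ + X]mxE.
Qed.

Lemma lattice_ptN k : lattice_pt (- k) = - lattice_pt k.
Proof. by rewrite /lattice_pt map_mxN mulNmx. Qed.

Lemma lattice_ptD k l : lattice_pt (k + l) = lattice_pt k + lattice_pt l.
Proof. by rewrite /lattice_pt map_mxD mulmxDl. Qed.

Lemma lattice_ptMn m k : m%:R *: lattice_pt k = lattice_pt (k *+ m).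
Proof.
rewrite scaler_nat; elim: m => [|m IH]; last by rewrite !mulrS lattice_ptD IH.
by rewrite !mulr0n /lattice_pt map_mx0 mul0mx.
Qed.

Lemma cell_coord_subl x k i :
  cell_coord (x - lattice_pt k) 0 i = cell_coord x 0 i - (k 0 i)%:~R.
Proof. by rewrite -lattice_ptN cell_coord_addl [(- k) 0 i]mxE mulrNz. Qed.

Lemma measurable_cell_coord i :
  measurable_fun [set: E] (fun x : E => cell_coord x 0 i).
Proof.
rewrite (_ : (fun x => _) =
    (fun x : E => \sum_j (fun j (x : E) => (x : rV) 0 j * invmx P j i) j x)).
  apply: (measurable_sum (D := [set: E])) => j.
  by apply: measurable_funM; [exact: measurable_coord|exact: measurable_cst].
by apply/funext => x; rewrite /cell_coord mxE.
Qed.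

Lemma measurable_shifted_cell s : measurable (shifted_cell s).
Proof.
rewrite (_ : shifted_cell s =
    \bigcap_(i in [set: 'I_n.+1]) [set x : E | s <= cell_coord x 0 i < s + 1]).
  apply: fin_bigcap_measurable => // i _.
  rewrite -[X in measurable X]setTI.
  have := measurable_cell_coord i measurableT (measurable_itv `[s, s + 1[).
  by congr (measurable (_ `&` _)); apply/seteqP; split=> x /=; rewrite in_itv.
by apply/seteqP; split=> [x xs i _|x xs i]; exact: xs.
Qed.

(** The index is the floor of the coordinates measured from the corner. The sigma type lets
    reduction modulo the lattice be defined as a function. *)
Lemma shifted_cell_index s (x : rV) : {k | shifted_cell s (x - lattice_pt k)}.
Proof.
exists (\row_i Num.floor (cell_coord x 0 i - s)) => i.
rewrite cell_coord_subl [(\row__ _) 0 i]mxE.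
have := floor_itv (cell_coord x 0 i - s); rewrite intrD mulr1z.
by move=> /andP[] *; apply/andP; split; lra.
Qed.

Lemma shifted_cell_index_uniq s (x : rV) k l :
  shifted_cell s (x - lattice_pt k) -> shifted_cell s (x - lattice_pt l) -> k = l.
Proof.
move=> xk xl; apply/rowP => i; have := xk i; have := xl i.
rewrite !cell_coord_subl => H1 H2.
apply/eqP; rewrite eq_le -!ltzD1 -!(ltr_int R) !intrD !mulr1z.
by apply/andP; split; lra.
Qed.

Lemma lebesgue_rV_affine (s : R) (t : rV) (A : set E) : 0 < s ->
  mu [set x : E | A (s *: (x : rV) + t)%R] = ((s ^-1 ^+ n.+1)%:E * mu A)%E.
Proof. by move=> s0; exact: lebesgue_outer_affine. Qed.

Lemma lebesgue_rV_translate (t : rV) (A : set E) :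
  mu [set x : E | A ((x : rV) + t)%R] = mu A.
Proof.
have := @lebesgue_rV_affine 1 t A ltr01.
rewrite invr1 expr1n mul1e => <-; congr (mu _).
by apply/seteqP; split=> x /=; rewrite scale1r.
Qed.

Lemma measurable_translate (t : rV) (A : set E) : measurable A ->
  measurable [set x : E | A ((x : rV) + t)%R].
Proof.
move=> mA; rewrite (_ : mkset _ = [set x : E | A (1 *: (x : rV) + t)%R]).
  exact: measurable_affine.
by apply/seteqP; split=> x /=; rewrite scale1r.
Qed.

(** The first cell is cut by the translates of the second, and the second by the opposite translates
    of the first. The pieces with the same index are translates of each other, and [B] does not see
    the translation. *)
Lemma shifted_cell_periodic s t (B : set E) : measurable B -> lattice_periodic B ->
  mu (shifted_cell s `&` B) = mu (shifted_cell t `&` B).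
Proof.
move=> mB pB.
pose F u k : set E := [set x | shifted_cell u ((x : rV) - lattice_pt k)].
have mF u k : measurable (F u k).
  exact/measurable_translate/measurable_shifted_cell.
have cF u x : exists k, F u k x by have [k] := shifted_cell_index u x; exists k.
have dF u x k l : F u k x -> F u l x -> k = l by exact: shifted_cell_index_uniq.
(* The sign is opposite to that in [F], so that translation by [lattice_pt k] matches the two pieces
   of index [k]. *)
pose F' u k : set E := [set x | shifted_cell u ((x : rV) + lattice_pt k)].
have mF' u k : measurable (F' u k).
  exact/measurable_translate/measurable_shifted_cell.
have cF' u x : exists k, F' u k x.
  by have [k] := shifted_cell_index u x; exists (- k); rewrite /F'/= lattice_ptN.
have dF' u x k l : F' u k x -> F' u l x -> k = l.
  have F'E m : F' u m x -> shifted_cell u (x - lattice_pt (- m)).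
    by rewrite lattice_ptN opprK.
  by move=> /F'E Fk /F'E Fl; apply: oppr_inj; exact: shifted_cell_index_uniq Fk Fl.
have mSB u : measurable (shifted_cell u `&` B).
  by apply: measurableI => //; exact: measurable_shifted_cell.
rewrite (measure_partition mu (mSB s) (mF t) (cF t) (dF t)).
rewrite (measure_partition mu (mSB t) (mF' s) (cF' s) (dF' s)).
apply: eq_eseriesr => j _; case: pickle_inv => [k|] /=; last by rewrite !setI0.
rewrite -(lebesgue_rV_translate (lattice_pt k)); congr (mu _).
apply/seteqP; split=> x /=; rewrite /F/F'/= addrK.
  by move=> [[xs /pB xB] xt].
by move=> [[xt xB] xs]; split=> //; split=> //; exact/pB.
Qed.

(** The cell splits into [m ^ n.+1] subcells, each mapped onto the whole cell by a dilation of ratio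
    [m] and a lattice translation. Each piece therefore has measure [m ^- n.+1] times that of the
    right-hand side, and their number cancels the factor. *)
Lemma shifted_cell_scale (m : nat) (B : set E) : (0 < m)%N ->
  measurable B -> lattice_periodic B ->
  mu (shifted_cell 0 `&` [set x : E | B (m%:R *: (x : rV))]) = mu (shifted_cell 0 `&` B).
Proof.
move=> m0 mB pB; have m0R : 0 < m%:R :> R by rewrite ltr0n.
pose L (f : {ffun 'I_n.+1 -> 'I_m}) := lattice_pt (\row_i (f i)%:Z).
pose F f : set E := [set x | (shifted_cell 0 `&` B) (m%:R *: (x : rV) + - L f)].
have mS := measurable_shifted_cell 0.
have mF f : measurable (F f) by apply: measurable_affine => //; exact: measurableI.
have FE f : mu (F f) = ((m%:R^-1 ^+ n.+1)%:E * mu (shifted_cell 0 `&` B))%E.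
  exact: lebesgue_rV_affine.
have dF : trivIset [set: {ffun 'I_n.+1 -> 'I_m}] F.
  apply/trivIsetP => f g _ _; apply: contraNeq => /set0P[x [[xf _] [xg _]]].
  have /rowP fg := shifted_cell_index_uniq xf xg.
  apply/eqP/ffunP => i; have := fg i; rewrite !mxE => -[] /val_inj.
  exact.
have -> : shifted_cell 0 `&` [set x : E | B (m%:R *: (x : rV))] =
    \bigcup_(f in [set: {ffun 'I_n.+1 -> 'I_m}]) F f.
  apply/seteqP; split=> [x [xS xB]|x [f _ [xf xB]]]; last first.
    split; last first.
      by have /= := xB; rewrite /L -lattice_ptN => /pB.
    move=> i; have := xf i; rewrite /L cell_coord_subl cell_coordZ.
    rewrite [(\row__ _) 0 i]mxE [(_ *: cell_coord x) 0 i]mxE !add0r.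
    set c := cell_coord x 0 i => /andP[h1 h2].
    have fm : (f i)%:R + 1 <= m%:R :> R by rewrite natr1 ler_nat ltn_ord.
    have f0 : 0 <= (f i)%:R :> R by [].
    have {}h1 : (f i)%:R <= m%:R * c by move: h1; rewrite -pmulrn subr_ge0.
    have {}h2 : m%:R * c < (f i)%:R + 1 by move: h2; rewrite -pmulrn ltrBlDr addrC.
    apply/andP; split; first by rewrite -(pmulr_rge0 _ m0R) (le_trans f0).
    by rewrite -(ltr_pM2l m0R) mulr1 (lt_le_trans h2).
  have [k xk] := shifted_cell_index 0 (m%:R *: x).
  (* The coordinates of [m x] lie between [0] and [m], excluding [m], so their floors are valid
     subcell indices. *)
  have k0m i : exists j : 'I_m, k 0 i = j%:Z.
    have := xk i; rewrite cell_coord_subl cell_coordZ [(_ *: cell_coord x) 0 i]mxE.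
    have := xS i; set c := cell_coord x 0 i; rewrite !add0r => /andP[c0 c1] /andP[h1 h2].
    have : (k 0 i)%:~R < m%:R :> R.
      rewrite subr_ge0 in h1; apply: (le_lt_trans h1).
      by rewrite -[ltRHS]mulr1 ltr_pM2l.
    have : 0 < (k 0 i)%:~R + 1 :> R.
      by rewrite ltrBlDr in h2; rewrite addrC (le_lt_trans _ h2)// mulr_ge0// ltW.
    rewrite pmulrn ltr_int -[1]/(1%:~R) -intrD ltr0z ltzD1.
    by case: (k 0 i) => // j _ jm; exists (Ordinal jm).
  have [f fE] := choice k0m.
  have fE' : k = \row_i ([ffun i => f i] i)%:Z.
    by apply/rowP => i; rewrite !mxE ffunE fE.
  exists [ffun i => f i] => //; split; rewrite /= /L -fE'//.
  by rewrite -lattice_ptN; exact/pB.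
have fin : finite_set [set: {ffun 'I_n.+1 -> 'I_m}] by exact: finite_finset.
rewrite measure_fin_bigcup// fsbig_finite//=.
rewrite (perm_big (enum {ffun 'I_n.+1 -> 'I_m})); last first.
  apply: uniq_perm; rewrite ?enum_uniq ?finmap.fset_uniq// => f.
  by rewrite mem_enum in_fset_set// in_setT.
rewrite big_enum/= (eq_bigr _ (fun f _ => FE f)) -ge0_sume_distrl; last first.
  by move=> f _; rewrite lee_fin exprn_ge0// invr_ge0.
rewrite sumEFin sumr_const card_ffun !card_ord -[_ *+ (m ^ _)%N]mulr_natr natrX -exprMn.
by rewrite mulVf ?gt_eqF// expr1n mul1e.
Qed.
End cell.

(** * The open cell and multiplication by an integer modulo the lattice *)

Section centred_cell.
Context {R : realType} {n : nat} (P : 'M[R]_n.+1) (Pu : P \in unitmx).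
Local Notation rV := 'rV[R]_n.+1.
Local Notation mu := (@lebesgue_rV R n).
Local Notation E := (lebesgue_type R n).

Definition centred_cell : set E :=
  [set x | forall i, - 2^-1 < cell_coord P x 0 i < 2^-1].

Let Q : set E := shifted_cell P (- 2^-1).

Let half1 : - 2^-1 + 1 = 2^-1 :> R.
Proof. lra. Qed.

Let mQ : measurable Q. Proof. exact: measurable_shifted_cell. Qed.

Let cellQ : centred_cell `<=` Q.
Proof.
by move=> x xY i; have /andP[/ltW h1 h2] := xY i; rewrite half1; apply/andP.
Qed.

Lemma measurable_centred_cell : measurable centred_cell.
Proof.
rewrite (_ : centred_cell =
    \bigcap_(i in [set: 'I_n.+1]) [set x : E | - 2^-1 < cell_coord P x 0 i < 2^-1]).
  apply: fin_bigcap_measurable => // i _.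
  rewrite -[X in measurable X]setTI.
  have := measurable_cell_coord P i measurableT (measurable_itv `](- 2^-1), 2^-1[).
  by congr (measurable (_ `&` _)); apply/seteqP; split=> x /=; rewrite in_itv.
by apply/seteqP; split=> [x xs i _|x xs i]; exact: xs.
Qed.

Let Qlty : (mu Q < +oo)%E.
Proof.
(* Points of [Q] have cell coordinates of absolute value at most one, hence entries bounded by [b].
   Boxes are open below, so one more unit is subtracted on that side. *)
pose b : rV := \row_j \sum_i `|P i j|.
apply: le_lt_trans (lebesgue_outer_box_lty (- b - const_mx 1) b).
apply: le_outer_measure => x xQ j.
have -> : x 0 j = \sum_i cell_coord P x 0 i * P i j.
  by rewrite -[in LHS](mulmxKV Pu x) [LHS]mxE.
have H : `|\sum_i cell_coord P x 0 i * P i j| <= b 0 j.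
  rewrite mxE; apply: (le_trans (ler_norm_sum _ _ _)); apply: ler_sum => i _.
  rewrite normrM ler_piMl// ler_norml; have := xQ i; rewrite half1.
  by move=> /andP[] *; apply/andP; split; lra.
move: H; rewrite ler_norml !mxE => /andP[h1 h2]; apply/andP; split=> //.
by rewrite (lt_le_trans _ h1)// ltrBlDr ltrDl.
Qed.

(** Otherwise countably many null translates would cover the whole space, which contains the unit
    cube. *)
Let Qgt0 : (0 < mu Q)%E.
Proof.
rewrite lt0e measure_ge0 andbT; apply/eqP => Q0.
pose F k : set E := [set x | Q ((x : rV) - lattice_pt P k)].
have mF k : measurable (F k) by exact/measurable_translate.
have cF x : exists k, F k x by have [k] := shifted_cell_index Pu (- 2^-1) x; exists k.
have dF x k l : F k x -> F l x -> k = l by exact: shifted_cell_index_uniq.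
have := measure_partition mu measurableT mF cF dF.
rewrite eseries0 => [T0|j _ _]; last first.
  apply/eqP; rewrite eq_le measure_ge0 andbT -[leRHS]Q0 setTI.
  case: pickle_inv => [k|] /=; last by rewrite measure0 measure_ge0.
  by rewrite lebesgue_rV_translate.
have : (1 <= mu [set: E])%E.
  exact: le_trans lebesgue_outer_unit_cube (le_outer_measure _ _ _ (@subsetT _ _)).
by rewrite -[mu _]/(mu [set: E]) T0 lee_fin ler10.
Qed.

(* Dilating the open cell by any [s > 1] covers [Q], so the boundary is null. *)
Lemma lebesgue_centred_cell : mu centred_cell = mu Q.
Proof.
have mY := measurable_centred_cell.
have YQ : (mu centred_cell <= mu Q)%E by exact: le_outer_measure.
apply/eqP; rewrite eq_le YQ/=.
have Yfin : mu centred_cell \is a fin_num.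
  by rewrite ge0_fin_numE// (le_lt_trans YQ).
have Qfin : mu Q \is a fin_num by rewrite ge0_fin_numE.
rewrite -(fineK Yfin) -(fineK Qfin) lee_fin.
have H s : 1 < s -> fine (mu Q) <= s ^+ n.+1 * fine (mu centred_cell).
  move=> s1; have s0 : 0 < s^-1 by rewrite invr_gt0 (lt_trans _ s1).
  rewrite -lee_fin EFinM !fineK//.
  have := @lebesgue_rV_affine R n s^-1 0 centred_cell s0.
  rewrite invrK => <-; apply: le_outer_measure => x xQ i.
  rewrite addr0 cell_coordZ [(_ *: cell_coord P x) 0 i]mxE.
  have := xQ i; rewrite half1 => /andP[h1 h2].
  have s1' : s^-1 < 1 by rewrite invf_lt1// (lt_trans _ s1).
  by apply/andP; split; nra.
have : (fun s => s ^+ n.+1 * fine (mu centred_cell)) @ (1 : R)^'+ -->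
    1 ^+ n.+1 * fine (mu centred_cell).
  apply: cvg_at_right_filter; apply: cvgMl.
  exact: exprn_continuous.
rewrite expr1n mul1r => /cvgr_to_ge; apply.
by near=> s; apply: H; near: s; exact: nbhs_right_gt.
Unshelve. all: by end_near. Qed.

Lemma lebesgue_centred_cell_lty : (mu centred_cell < +oo)%E.
Proof. by rewrite lebesgue_centred_cell. Qed.

Lemma lebesgue_centred_cell_gt0 : (0 < mu centred_cell)%E.
Proof. by rewrite lebesgue_centred_cell. Qed.

Let cellI (C : set E) : measurable C -> mu (centred_cell `&` C) = mu (Q `&` C).
Proof.
move=> mC; have mY := measurable_centred_cell.
have mD : measurable (Q `\` centred_cell) by exact: measurableD.
have D0 : mu (Q `\` centred_cell) = 0%E.
  rewrite measureD//= setIidr// lebesgue_centred_cell subee//.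
  by rewrite ge0_fin_numE.
rewrite (measureDI mu (measurableI _ _ mQ mC) mY).
rewrite [X in (X + _)%E](_ : _ = 0%E); last first.
  apply: (@subset_measure0 _ _ _ mu _ (Q `\` centred_cell)) => //.
  - by apply: measurableD => //; exact: measurableI.
  - by move=> x [[xQ _] xY].
rewrite add0e; congr (mu _); apply/seteqP; split=> [x [xY xC]|x [[]]]//.
by split=> //; split=> //; exact: cellQ.
Qed.

(* [T x] is [m x] reduced modulo the lattice, except on a null set, which [T] sends
   to a point outside the cell. *)
Lemma cell_selfmap (m : nat) : (0 < m)%N -> exists T : E -> E,
  [/\ measurable_fun [set: E] T,
      T @^-1` centred_cell `<=` centred_cell,
      forall x, centred_cell (T x) ->
        exists k, m%:R *: (x : rV) = (T x : rV) + lattice_pt P k &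
      forall A, measurable A -> A `<=` centred_cell -> mu (T @^-1` A) = mu A].
Proof.
move=> m0; have mY := measurable_centred_cell.
pose idx (x : rV) := sval (shifted_cell_index Pu (- 2^-1) x).
pose rho (x : rV) : rV := x - lattice_pt P (idx x).
have rhoQ x : Q (rho x) by exact: svalP (shifted_cell_index Pu (- 2^-1) x).
have rhoD x k : rho (x + lattice_pt P k) = rho x.
  have -> : rho (x + lattice_pt P k) = x + lattice_pt P k - lattice_pt P (idx x + k).
    rewrite /rho; congr (_ - lattice_pt P _).
    apply: (shifted_cell_index_uniq Pu (rhoQ (x + lattice_pt P k))).
    by rewrite lattice_ptD opprD addrACA subrr addr0; exact: rhoQ.
  by rewrite lattice_ptD opprD addrACA subrr addr0.
have rho_id x : Q x -> rho x = x.
  move=> Qx; have p0 : lattice_pt P 0 = 0 by rewrite /lattice_pt map_mx0 mul0mx.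
  have idx0 : idx x = 0.
    apply: (shifted_cell_index_uniq Pu (rhoQ x)).
    by rewrite p0 subr0.
  by rewrite /rho idx0 p0 subr0.
(* A preimage under [rho] is a countable union of lattice translates of the part of [A] inside
   [Q]. *)
have mrho (A : set E) : measurable A -> measurable [set x : E | A (rho x)].
  move=> mA; rewrite (_ : mkset _ =
      \bigcup_k [set x : E | (A `&` Q) ((x : rV) + - lattice_pt P k)]).
    apply: countable_bigcupT_measurable => [|k].
      exact: countableP.
    by apply: measurable_translate; exact: measurableI.
  apply/seteqP; split=> [x Ax|x [k _ [Ax Qx]]].
    by exists (idx x) => //; split=> //; exact: rhoQ.
  by rewrite /= -(subrK (lattice_pt P k) x) rhoD rho_id.
(* A vertex of the closed cell, hence outside the open one: the default value of [T]. *)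
pose p : rV := const_mx 2^-1 *m P.
have pY : ~ centred_cell p.
  by move=> /(_ ord0); rewrite /cell_coord mulmxK// mxE ltxx andbF.
pose T (x : E) : E :=
  if `[< centred_cell x /\ centred_cell (rho (m%:R *: (x : rV))) >]
  then rho (m%:R *: (x : rV)) else p.
have TA (A : set E) : A `<=` centred_cell ->
    T @^-1` A = centred_cell `&` [set x : E | A (rho (m%:R *: (x : rV)))].
  move=> AY; apply/seteqP; split=> x /=; rewrite /T.
    by case: asboolP => [[xY _] Ax|_ /AY//].
  by move=> [xY Ax]; case: asboolP => // h; case: h; split=> //; exact: AY.
have mscale (A : set E) : measurable A -> measurable [set x : E | A (m%:R *: (x : rV))].
  move=> mA; rewrite (_ : mkset _ = [set x : E | A (m%:R *: (x : rV) + 0)%R]).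
    by apply: measurable_affine => //; rewrite ltr0n.
  by apply/seteqP; split=> x /=; rewrite addr0.
have mTA (A : set E) : measurable A -> A `<=` centred_cell -> measurable (T @^-1` A).
  move=> mA AY; rewrite TA//; apply: measurableI => //.
  exact: (mscale _ (mrho _ mA)).
exists T; split.
- move=> _ A mA; rewrite setTI.
  have mTY : measurable (T @^-1` centred_cell) by exact: mTA.
  have mTAY : measurable (T @^-1` (A `&` centred_cell)).
    by apply: mTA => //; exact: measurableI.
  have Tp x : ~ centred_cell (T x) -> T x = p by rewrite /T; case: asboolP => // -[].
  (* Where it leaves the open cell, [T] is constantly [p], so whether [p] lies in [A] decides if
     that part belongs to the preimage. *)
  have [Ap|Ap] := pselect (A p).
    rewrite (_ : _ @^-1` _ = T @^-1` (A `&` centred_cell) `|` ~` (T @^-1` centred_cell)).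
      by apply: measurableU => //; exact: measurableC.
    apply/seteqP; split=> x /=; last by move=> [[]//|/Tp ->].
    by have [h|h] := pselect (centred_cell (T x)); [left|right].
  rewrite (_ : _ @^-1` _ = T @^-1` (A `&` centred_cell))//.
  apply/seteqP; split=> x /=; last by move=> [].
  by have [h|/Tp ->//] := pselect (centred_cell (T x)).
- by rewrite TA// => x [].
- move=> x; rewrite /T; case: asboolP => // _ _; exists (idx (m%:R *: (x : rV))).
  by rewrite /rho subrK.
- move=> A mA AY; rewrite TA//.
  pose B : set E := [set x : E | A (rho x)].
  have mB : measurable B by exact: mrho.
  have pB : lattice_periodic P B by move=> x k; rewrite /B/= rhoD.
  rewrite -[X in _ `&` X]/([set x : E | B (m%:R *: (x : rV))]).
  have mmB := mscale _ mB.
  have pmB : lattice_periodic P [set x : E | B (m%:R *: (x : rV))].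
    by move=> x k; rewrite /= scalerDr lattice_ptMn; exact: pB.
  (* Pass to the half-open cell, move its corner to [0] where the dilation lemma applies, then move
     it back. *)
  rewrite cellI// (shifted_cell_periodic Pu _ 0 mmB pmB) shifted_cell_scale//.
  rewrite (shifted_cell_periodic Pu _ (- 2^-1) mB pB); congr (mu _).
  apply/seteqP; split=> x /=.
    by move=> [xQ]; rewrite /B/= rho_id.
  by move=> Ax; have Qx := cellQ (AY _ Ax); split=> //; rewrite /B/= rho_id.
Qed.

End centred_cell.

(** * Minimisers of tilted convex functions *)

Section vectors.
Context {R : realType} {M : nat}.
Implicit Types (x y z xi : 'rV[R]_M.+1).

Definition dot x y : R := \sum_i x 0 i * y 0 i.

Lemma dotDl x y z : dot (x + y) z = dot x z + dot y z.
Proof. by rewrite /dot -big_split; apply: eq_bigr => i _; rewrite mxE mulrDl. Qed.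

Lemma dotDr x y z : dot x (y + z) = dot x y + dot x z.
Proof. by rewrite /dot -big_split; apply: eq_bigr => i _; rewrite mxE mulrDr. Qed.

Lemma dotZl a x y : dot (a *: x) y = a * dot x y.
Proof. by rewrite /dot mulr_sumr; apply: eq_bigr => i _; rewrite mxE mulrA. Qed.

Lemma dotZr a x y : dot x (a *: y) = a * dot x y.
Proof. by rewrite /dot mulr_sumr; apply: eq_bigr => i _; rewrite mxE mulrCA. Qed.

Lemma dotNl x y : dot (- x) y = - dot x y.
Proof. by rewrite -scaleN1r dotZl mulN1r. Qed.

Lemma dotNr x y : dot x (- y) = - dot x y.
Proof. by rewrite -scaleN1r dotZr mulN1r. Qed.

Lemma dot0r x : dot x 0 = 0.
Proof. by rewrite /dot big1// => i _; rewrite mxE mulr0. Qed.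

Lemma dot_delta i a y : dot (a *: delta_mx 0 i) y = a * y 0 i.
Proof.
rewrite dotZl /dot (bigD1 i)//= mxE !eqxx mul1r big1 ?addr0// => j /negPf ji.
by rewrite mxE ji andbF mul0r.
Qed.

Lemma entry_le_norm x i : `|x 0 i| <= `|x|.
Proof.
rewrite [leRHS]/Num.norm /= mx_normrE.
exact: (le_bigmax_cond _ (fun ij : 'I_1 * 'I_M.+1 => `|x ij.1 ij.2|) (_ : xpredT (0, i))).
Qed.

Lemma norm_le_entry x (c : R) : (forall i, `|x 0 i| <= c) -> `|x| <= c.
Proof.
move=> H; rewrite [leLHS]/Num.norm /= mx_normrE; apply: bigmax_le => [|[i j] _ /=].
  exact: le_trans (normr_ge0 _) (H ord0).
by rewrite (ord1 i).
Qed.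

Lemma dot_le x y : `|dot x y| <= M.+1%:R * `|x| * `|y|.
Proof.
rewrite /dot; apply: (le_trans (ler_norm_sum _ _ _)).
have -> : M.+1%:R * `|x| * `|y| = \sum_(i < M.+1) `|x| * `|y|.
  by rewrite sumr_const card_ord -[RHS]mulr_natl mulrA.
by apply: ler_sum => i _; rewrite normrM ler_pM// entry_le_norm.
Qed.

(** The bars denote the maximum norm, which governs the topology of row vectors; the growth
    condition uses the Euclidean one. This bound and [eucl_le_norm] pass between the two. *)
Lemma norm_le_eucl x : `|x| <= eucl_norm x.
Proof.
apply: norm_le_entry => i; rewrite -sqrtr_sqr ler_wsqrtr// (bigD1 i)//= lerDl.
by apply: sumr_ge0 => j _; exact: sqr_ge0.
Qed.

Lemma eucl_ge0 x : 0 <= eucl_norm x.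
Proof. exact: sqrtr_ge0. Qed.

Lemma eucl_le_norm x : eucl_norm x <= M.+1%:R * `|x|.
Proof.
rewrite -[leRHS]ger0_norm ?mulr_ge0// -sqrtr_sqr ler_wsqrtr//.
apply: (@le_trans _ _ (\sum_(i < M.+1) `|x| ^+ 2)).
  by apply: ler_sum => i _; rewrite -[leLHS]real_normK ?num_real//;
    rewrite lerXn2r ?nnegrE// entry_le_norm.
rewrite sumr_const card_ord exprMn -[leLHS]mulr_natl ler_wpM2r ?sqr_ge0//.
by rewrite -natrX ler_nat expnS leq_pmulr// expn1.
Qed.

Lemma dot_continuous xi : continuous (dot xi).
Proof.
rewrite /dot; apply: continuous_big; first exact: add_continuous.
move=> i _ x; apply: (@continuousM R _ (cst (xi 0 i)) (fun z : 'rV[R]_M.+1 => z 0 i)).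
  exact: cst_continuous.
exact: coord_continuous.
Qed.

End vectors.

Lemma convex_envelope_convex (R : realType) (M : nat) (f : 'rV[R]_M -> R) z :
  strictly_convex f -> convex_envelope f z = (f z)%:E.
Proof.
move=> cf; apply/eqP; rewrite eq_le; apply/andP; split.
  by apply: ge_ereal_sup => _ [g [_ gf] <-]; rewrite lee_fin gf.
apply: ereal_sup_ubound; exists f => //; split=> // t x y _ _.
have [->|t0] := eqVneq t 0%:i01; first by rewrite !conv0.
have [->|t1] := eqVneq t 1%:i01; first by rewrite !conv1.
have [->|xy] := eqVneq x y; first by rewrite !convmm.
by apply/ltW/cf => //; rewrite lt_neqAle eq_sym t0 ge0/= lt_neqAle t1 le1.
Qed.

(** Once [r] to the power [p - 1] exceeds [(S + 1) / a], the left side is at least [r - a], which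
    exceeds [b] as soon as [r] exceeds [a + b]. *)
Lemma powR_coercive (R : realType) (p a b S : R) : 1 < p -> 0 < a ->
  exists K, forall r, 0 <= r -> a * (r `^ p - 1) - S * r <= b -> r <= K.
Proof.
move=> p1 a0; have p10 : 0 < p - 1 by rewrite subr_gt0.
pose s := Num.max 0 ((S + 1) / a).
have s0 : 0 <= s by rewrite le_max lexx.
exists (Num.max 1 (Num.max (a + b) (s `^ (p - 1)^-1))) => r r0 H.
rewrite leNgt; apply/negP; rewrite !gt_max => /and3P[r1 rab rs].
have rp : s <= r `^ (p - 1).
  have -> : s = (s `^ (p - 1)^-1) `^ (p - 1).
    by rewrite -powRrM mulVf ?gt_eqF// powRr1.
  by apply: ge0_ler_powR; rewrite ?nnegrE ?powR_ge0 ?r0 ?ltW.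
have {}rp : S + 1 <= a * r `^ (p - 1).
  by rewrite mulrC -ler_pdivrMr// (le_trans _ rp)// le_max lexx orbT.
have : (S + 1) * r <= a * r `^ p.
  by rewrite -(@mulr_powRB1 _ r p)// ?(lt_trans _ p1)// [r * _]mulrC mulrA ler_wpM2r.
by move: H rab; nra.
Qed.

Section argmin.
Context {R : realType} {M : nat} (p c1 c2 : R) (p_gt1 : 1 < p) (c1_gt0 : 0 < c1).
Local Notation rV := 'rV[R]_M.+1.
Implicit Types (f : rV -> R) (xi z : rV).

(** One class containing every [V y] with [y] in the cell, so that bounds depending only on [p],
    [c1], [c2] are uniform in [y]. The bound at [0] controls the minimal values of the tilted
    functions. *)
Definition coercive_convex f := [/\ continuous f, strictly_convex f,
  forall z, c1 * (`|z| `^ p - 1) <= f z & f 0 <= c2].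

(** Its minimum over [z] is minus the Legendre conjugate of [f] at [xi]. *)
Definition tilt f xi z := f z - dot xi z.

Lemma tilt_continuous f xi : continuous f -> continuous (tilt f xi).
Proof. move=> cf z; apply: continuousB; [exact: cf|exact: dot_continuous]. Qed.

Lemma tilt_coercive (S b : R) : exists K, forall f xi z, coercive_convex f ->
  `|xi| <= S -> tilt f xi z <= b -> `|z| <= K.
Proof.
have [K HK] := @powR_coercive R p c1 b (M.+1%:R * S) p_gt1 c1_gt0.
exists K => f xi z [_ _ lf _] xiS fb; apply: HK => //.
apply: le_trans fb; apply: lerB => //.
apply: (le_trans (ler_norm _)); apply: (le_trans (dot_le _ _)).
by rewrite ler_wpM2r// ler_wpM2l.
Qed.

Lemma compact_norm_le (K : R) : compact [set z : rV | `|z| <= K].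
Proof.
apply: bounded_closed_compact.
  by exists K; split; [exact: num_real|move=> x Kx z /= /le_trans; apply; exact: ltW].
rewrite (_ : mkset _ = Num.norm @^-1` [set r : R | r <= K])//.
apply: closed_comp; last exact: closed_le.
by move=> z _; exact: norm_continuous.
Qed.

Lemma tilt_min_exists f xi : coercive_convex f ->
  exists w, forall z, tilt f xi w <= tilt f xi z.
Proof.
move=> cf; have [K HK] := tilt_coercive `|xi| (tilt f xi 0).
have [||w] := @EVT_min_rV R _ (tilt f xi) _ _ (@compact_norm_le K).
- by exists 0; apply: (HK f xi).
- by apply: continuous_subspaceT => z; apply: tilt_continuous; case: cf.
rewrite inE => wK Hw; exists w => z.
have [z0|/ltW z0] := lerP (tilt f xi z) (tilt f xi 0).
  by apply: Hw; rewrite inE; exact: (HK f xi).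
by apply: le_trans z0; apply: Hw; rewrite inE; exact: (HK f xi).
Qed.

Lemma tilt_min_uniq f xi w z : strictly_convex f ->
  (forall z, tilt f xi w <= tilt f xi z) -> tilt f xi z <= tilt f xi w -> z = w.
Proof.
move=> cf wmin zw; apply/eqP/negPn/negP => nzw.
have h : 0 < (2^-1 : R) < 1 by apply/andP; split; lra.
have := cf _ _ _ nzw h; have := wmin (2^-1 *: z + (1 - 2^-1) *: w).
by move: zw; rewrite /tilt !dotDr !dotZr; lra.
Qed.

(** Total in [f]: it is [0] if there is no minimiser and an arbitrary one if there are several. *)
Definition argmin f xi : rV :=
  xget 0 [set w | forall z, tilt f xi w <= tilt f xi z].

Lemma argminP f xi z : coercive_convex f -> tilt f xi (argmin f xi) <= tilt f xi z.
Proof.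
by move=> /(tilt_min_exists xi)[w Hw]; rewrite /argmin; case: xgetP => [_ _|/(_ w)]//; exact.
Qed.

Lemma argmin_bound (S : R) : exists2 K, 0 <= K & forall f xi, coercive_convex f ->
  `|xi| <= S -> `|argmin f xi| <= K.
Proof.
have [K HK] := tilt_coercive S c2.
exists (Num.max 0 K); rewrite ?le_max ?lexx// => f xi cf xiS.
rewrite le_max; apply/orP; right; apply: (HK f xi) => //.
apply: (le_trans (argminP xi 0 cf)); case: cf => _ _ _.
by rewrite /tilt dot0r subr0.
Qed.

(** On the compact set of bounded points at distance at least [e] from the minimiser, the tilted
    function attains its minimum, which uniqueness puts strictly above the global one. The gap
    provides [d]. *)
Lemma argmin_well_posed f xi (e : R) : coercive_convex f -> 0 < e ->
  exists2 d, 0 < d & forall z, tilt f xi z < tilt f xi (argmin f xi) + d ->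
    `|z - argmin f xi| < e.
Proof.
move=> cf e0; set w := argmin f xi.
have [K HK] := tilt_coercive `|xi| (tilt f xi w + 1).
pose A : set rV := [set z | `|z| <= K] `&` [set z | e <= `|z - w|].
have cA : compact A.
  apply: compact_closedI; first exact: compact_norm_le.
  rewrite (_ : mkset _ = (fun z => `|z - w|) @^-1` [set r : R | e <= r])//.
  apply: closed_comp; last exact: closed_ge.
  move=> z _; apply: continuous_comp; last exact: norm_continuous.
  by apply: (@continuousB _ _ _ id (cst w)); [exact: (fun _ => cvg_id)|exact: cst_continuous].
have [A0|nA0] := pselect (A !=set0); last first.
  exists 1 => // z zw; rewrite ltNge; apply/negP => ez; apply: nA0; exists z.
  by split=> //; apply: (HK f xi) => //; exact: ltW.
have [|z0] := @EVT_min_rV R _ (tilt f xi) _ A0 cA.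
  by apply: continuous_subspaceT => z; apply: tilt_continuous; case: cf.
rewrite inE => -[_ ez0] z0min.
have wz0 : tilt f xi w < tilt f xi z0.
  rewrite ltNge; apply/negP => z0w.
  suff z0E : z0 = w by move: ez0; rewrite /= z0E subrr normr0 leNgt e0.
  by apply: tilt_min_uniq z0w; [case: cf|move=> z; exact: argminP].
(* The cap at [1] keeps [z] in the sublevel set that [K] bounds. *)
exists (Num.min 1 (tilt f xi z0 - tilt f xi w)).
  by rewrite lt_min ltr01 subr_gt0.
move=> z; rewrite -ltrBlDl lt_min => /andP[z1 zz0].
rewrite ltNge; apply/negP => ez.
have : tilt f xi z0 <= tilt f xi z.
  apply: z0min; rewrite inE; split=> //; apply: (HK f xi) => //.
  by rewrite -lerBlDl ltW.
by rewrite leNgt; apply/negP/negPn; move: zz0; lra.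
Qed.

(** The minimiser for [xi'] is almost minimal for [xi]: its excess is at most the product of
    [xi' - xi] with the difference of the two minimisers, which are bounded uniformly near [xi].
    Well-posedness concludes. *)
Lemma argmin_continuous f xi (e : R) : coercive_convex f -> 0 < e ->
  exists2 d, 0 < d & forall xi', `|xi' - xi| < d ->
    `|argmin f xi' - argmin f xi| < e.
Proof.
move=> cf e0; have [d d0 Hd] := argmin_well_posed xi cf e0.
have [K K0 HK] := argmin_bound (`|xi| + 1).
pose C := M.+1%:R * (K + K) + 1.
have C0 : 0 < C by rewrite /C ltr_wpDl// mulr_ge0// addr_ge0.
exists (Num.min 1 (d / C)); first by rewrite lt_min ltr01 divr_gt0.
move=> xi'; rewrite lt_min => /andP[xi1 xid]; apply: Hd.
have wK : `|argmin f xi| <= K by apply: HK => //; rewrite lerDl.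
have w'K : `|argmin f xi'| <= K.
  apply: HK => //; rewrite -[xi'](subrK xi) (le_trans (ler_normD _ _))//.
  by rewrite addrC lerD2l ltW.
have := argminP xi' (argmin f xi) cf.
have : `|dot (xi' - xi) (argmin f xi' - argmin f xi)| < d.
  apply: (le_lt_trans (dot_le _ _)).
  have ww : `|argmin f xi' - argmin f xi| <= K + K.
    by rewrite (le_trans (ler_normB _ _))// lerD.
  apply: (@le_lt_trans _ _ (`|xi' - xi| * C)).
    rewrite mulrAC mulrC ler_wpM2l// /C.
    by rewrite (@le_trans _ _ (M.+1%:R * (K + K)))// ?ler_wpM2l// lerDl.
  by rewrite -ltr_pdivlMr.
move=> /(le_lt_trans (ler_norm _)).
by rewrite /tilt !dotDl !dotDr !dotNl !dotNr; lra.
Qed.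

End argmin.

(** * Measurability of Caratheodory compositions and minimisers *)

Lemma measurable_le_set d (T : measurableType d) (R : realType) (D : set T)
    (f g : T -> R) : measurable D -> measurable_fun D f -> measurable_fun D g ->
  measurable (D `&` [set x | f x <= g x]).
Proof. by move=> mD mf mg; apply: (measurable_fun_ler mf mg mD (Y := [set true])). Qed.

Section caratheodory.
Context d (T : measurableType d) {R : realType} {M : nat}.
Local Notation rV := 'rV[R]_M.+1.
Variables (D : set T) (W : T -> rV -> R).
Hypotheses (mD : measurable D) (mW : forall z, measurable_fun D (W ^~ z))
  (cW : forall x, D x -> continuous (W x)).

Let ratv (q : 'rV[rat]_M.+1) : rV := map_mx ratr q.

Let ratv_dense (z : rV) (e : R) : 0 < e ->
  exists q, forall i, z 0 i < ratv q 0 i < z 0 i + e.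
Proof.
move=> e0; have H i : exists r : rat, z 0 i < ratr r < z 0 i + e.
  have zze : z 0 i < z 0 i + e by rewrite ltrDl.
  by have [r] := rat_in_itvoo zze; rewrite in_itv; exists r.
have [f fP] := choice H; exists (\row_i f i) => i.
by rewrite !mxE.
Qed.

Let norm_lt_entry (z : rV) (e : R) : (`|z| < e) <-> (0 < e /\ forall i, `|z 0 i| < e).
Proof.
split=> [ze|[e0 ze]].
  split; first exact: le_lt_trans ze.
  by move=> i; exact: le_lt_trans (entry_le_norm z i) ze.
rewrite [ltLHS]/Num.norm /= mx_normrE; apply: bigmax_lt => // -[i j] _ /=.
by rewrite (ord1 i).
Qed.

Let continuous_near (f : rV -> R) (z : rV) (e : R) : continuous f -> 0 < e ->
  exists2 r, 0 < r & forall y, `|y - z| < r -> `|f y - f z| < e :> R.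
Proof.
move=> cf e0; have /cvgrPdist_lt/(_ _ e0) := cf z.
move=> /nbhs_ballP[r /= r0 H]; exists r => // y yz; rewrite distrC; apply: H.
by rewrite -ball_normE /= distrC.
Qed.

(** Approximating from above in coordinate [i] is what rules out [ratv q 0 i < c] in
    [measurable_argmin]. *)
Let ratv_norm_dense (z : rV) (e : R) (i : 'I_M.+1) : 0 < e ->
  exists q, `|ratv q - z| < e /\ z 0 i < ratv q 0 i.
Proof.
move=> e0; have [q qz] := ratv_dense z e0; exists q; split.
  apply/norm_lt_entry; split=> // j; have := qz j.
  by rewrite !mxE ltr_norml => /andP[] *; apply/andP; split; lra.
by have /andP[] := qz i.
Qed.

Let measurable_bigcap_rat (F : 'rV[rat]_M.+1 -> set T) :
  (forall q, measurable (F q)) -> measurable (\bigcap_q F q).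
Proof.
move=> mF; rewrite -[X in measurable X]setCK setC_bigcap; apply: measurableC.
by apply: countable_bigcupT_measurable => [|q]; [exact: countableP|exact: measurableC].
Qed.

Let measurable_bigcup_rat (F : 'rV[rat]_M.+1 -> set T) :
  (forall q, measurable (F q)) -> measurable (\bigcup_q F q).
Proof.
by move=> mF; apply: countable_bigcupT_measurable => [|q]; [exact: countableP|].
Qed.

Let dl (k : nat) : R := k.+1%:R^-1.

Let dl_gt0 k : 0 < dl k. Proof. by rewrite invr_gt0. Qed.

Let small_inv (e : R) : 0 < e -> exists k, dl k < e.
Proof.
move=> e0; rewrite /dl; exists (Num.truncn e^-1); rewrite invf_plt ?posrE//.
by rewrite truncnS_gt.
Qed.

(** By continuity, [W x (u x) < c] holds exactly when, for some [k] and [j], all rational points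
    closer than [dl j] to [u x] in every entry have value at most [c - dl k]. Only countably many
    conditions are involved. *)
Lemma measurable_caratheodory_comp (u : T -> rV) :
  (forall i, measurable_fun D (fun x => u x 0 i)) ->
  measurable_fun D (fun x => W x (u x)).
Proof.
move=> mu; apply: measurable_fun_ltP => c.
rewrite (_ : _ `&` _ = \bigcup_k \bigcup_j \bigcap_q (D `&`
   ([set x | exists i, dl j <= `|ratv q 0 i - u x 0 i|] `|`
    [set x | W x (ratv q) <= c - dl k]))); last first.
  apply/seteqP; split=> [x [Dx /= Wc]|x [k _ [j _ H]]].
    have gap : 0 < (c - W x (u x)) / 2 by rewrite divr_gt0// subr_gt0.
    have [k ck] := small_inv gap.
    have [r r0 Hr] := continuous_near (u x) (cW Dx) gap.
    have [j jr] := small_inv r0.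
    exists k => //; exists j => // q _; split=> //.
    have [h|h] := pselect (exists i, dl j <= `|ratv q 0 i - u x 0 i|); [by left|right => /=].
    have : `|ratv q - u x| < r.
      apply/norm_lt_entry; split=> // i; apply: lt_trans jr; rewrite ltNge.
      apply/negP => ij; apply: h; exists i; move: ij; rewrite 2!mxE.
      by rewrite [(- u x) 0 i]mxE.
    by move=> /Hr /= /(le_lt_trans (ler_norm _)); move: ck; lra.
  have Dx : D x by have [] := H 0 I.
  split=> //=; have k0 := dl_gt0 k.
  have [r r0 Hr] := continuous_near (u x) (cW Dx) k0.
  have rj0 : 0 < Num.min r (dl j) by rewrite lt_min r0 dl_gt0.
  have [q [qu _]] := ratv_norm_dense (u x) ord0 rj0.
  move: qu; rewrite lt_min => /andP[/Hr qr /norm_lt_entry[_ qj]].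
  have [_ [[i]|/=]] := H q I; last by move: qr; rewrite ltr_norml => /andP[]; lra.
  by have := qj i; rewrite 2!mxE [(- u x) 0 i]mxE ltNge => /negP.
apply: bigcupT_measurable => k; apply: bigcupT_measurable => j.
apply: measurable_bigcap_rat => q; rewrite setIUr; apply: measurableU.
  rewrite (_ : _ `&` _ = \bigcup_(i in [set: 'I_M.+1])
      (D `&` [set x | dl j <= `|ratv q 0 i - u x 0 i|])).
    apply: fin_bigcup_measurable => // i _.
    apply: measurable_le_set => //; apply: measurableT_comp => //.
    exact: measurable_funB.
  apply/seteqP; split=> x /=; first by move=> [Dx [i]]; exists i.
  by move=> [i _ [Dx]]; split=> //; exists i.
by apply: measurable_le_set.
Qed.

(** Entry [i] of the minimiser is below [c] exactly when some rational [q0] beats, by a margin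
    [dl k], every rational point whose entry [i] is at least [c]. Well-posedness gives the margin;
    conversely, rational points just above the minimiser in that entry would violate it. *)
Lemma measurable_argmin (p c1 c2 : R) (xi : rV) i : 1 < p -> 0 < c1 ->
  (forall x, D x -> coercive_convex p c1 c2 (W x)) ->
  measurable_fun D (fun x => argmin (W x) xi 0 i).
Proof.
move=> p1 c10 ccW; apply: measurable_fun_ltP => c.
have mt z : measurable_fun D (fun x => tilt (W x) xi z).
  by apply: measurable_funB.
rewrite (_ : _ `&` _ = \bigcup_k \bigcup_q0 \bigcap_q (D `&`
   ([set x | ratv q 0 i < c] `|`
    [set x | tilt (W x) xi (ratv q0) + dl k <= tilt (W x) xi (ratv q)]))); last first.
  apply/seteqP; split=> [x [Dx /= wc]|x [k _ [q0 _ H]]].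
    have ct := @tilt_continuous _ _ _ xi (cW Dx).
    have [e e0 He] := argmin_well_posed p1 c10 xi (ccW _ Dx)
      (ltac:(by rewrite subr_gt0) : 0 < c - argmin (W x) xi 0 i).
    have e2 : 0 < e / 2 by rewrite divr_gt0.
    have [k ke] := small_inv e2.
    have [r r0 Hr] := continuous_near (argmin (W x) xi) ct e2.
    have [q0 [/Hr q0w _]] := ratv_norm_dense (argmin (W x) xi) i r0.
    exists k => //; exists q0 => // q _; split=> //.
    have [h|h] := ltP (tilt (W x) xi (ratv q)) (tilt (W x) xi (argmin (W x) xi) + e).
      left; have /norm_lt_entry[_ /(_ i)] := He _ h.
      by rewrite 2!mxE [(- argmin _ _) 0 i]mxE => /(le_lt_trans (ler_norm _)) /=; lra.
    by right => /=; move: q0w; rewrite ltr_norml => /andP[_]; lra.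
  have Dx : D x by have [] := H 0 I.
  split=> //=; have ct := @tilt_continuous _ _ _ xi (cW Dx).
  rewrite ltNge; apply/negP => cw.
  have k0 := dl_gt0 k.
  have [r r0 Hr] := continuous_near (argmin (W x) xi) ct k0.
  have [q [/Hr qw qi]] := ratv_norm_dense (argmin (W x) xi) i r0.
  have [_ [/=|/=]] := H q I; first by rewrite ltNge (le_trans cw)// ltW.
  have := argminP p1 c10 xi (ratv q0) (ccW _ Dx).
  by move: qw; rewrite ltr_norml => /andP[_]; lra.
apply: bigcupT_measurable => k; apply: measurable_bigcup_rat => q0.
apply: measurable_bigcap_rat => q; rewrite setIUr; apply: measurableU.
  have [h|h] := boolP (ratv q 0 i < c).
    by rewrite (_ : [set x | _] = setT) ?setIT//; apply/seteqP.
  by rewrite (_ : [set x | _] = set0) ?setI0//; apply/seteqP; split=> x //=; rewrite (negPf h).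
apply: measurable_le_set => //.
exact: measurable_funD.
Qed.

End caratheodory.

(** * Existence of a multiplier *)

Section duality.
Context d (T : measurableType d) {R : realType} (mu : {measure set T -> \bar R}).
Variables (D : set T) (mD : measurable D) (Dlty : (mu D < +oo)%E).

Lemma integrable_bounded (f : T -> R) (K : R) :
  measurable_fun D f -> (forall x, D x -> `|f x| <= K) ->
  mu.-integrable D (EFin \o f).
Proof.
move=> mf fK; apply: measurable_bounded_integrable => //.
by exists K; split; [exact: num_real|move=> B KB x Dx /=; rewrite (le_trans (fK _ Dx))// ltW].
Qed.

Lemma integrable_const (c : R) : mu.-integrable D (EFin \o (fun=> c)).
Proof. exact: (@integrable_bounded _ `|c|). Qed.

Section vector.
Context {M : nat}.
Local Notation rV := 'rV[R]_M.+1.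

Definition vint (u : T -> rV) : rV := \row_i \int[mu]_(x in D) u x 0 i.

Lemma integrable_dot (xi : rV) (u : T -> rV) :
  (forall i, mu.-integrable D (EFin \o (fun x => u x 0 i))) ->
  mu.-integrable D (EFin \o (fun x => dot xi (u x))).
Proof.
move=> iu; rewrite (_ : EFin \o _ =
    fun x => (\sum_i ((xi 0 i)%:E * (u x 0 i)%:E))%E); last first.
  by apply/funext => x /=; rewrite /dot -sumEFin.
by apply: integrable_sum => // i _; exact: (integrableZl mD (xi 0 i) (iu i)).
Qed.

Lemma Rintegral_dot (xi : rV) (u : T -> rV) :
  (forall i, mu.-integrable D (EFin \o (fun x => u x 0 i))) ->
  \int[mu]_(x in D) dot xi (u x) = dot xi (vint u).
Proof.
move=> iu; apply: EFin_inj; rewrite /Rintegral fineK; last first.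
  by apply: integrable_fin_num => //; exact: integrable_dot.
under eq_integral do rewrite /dot -sumEFin.
rewrite (@integral_sum _ _ _ _ _ _ _ (fun i x => (xi 0 i * u x 0 i)%:E))//; last first.
  by move=> i; exact: (integrableZl mD (xi 0 i) (iu i)).
rewrite /dot -sumEFin; apply: eq_bigr => i _.
rewrite mxE EFinM /Rintegral fineK; last exact: (integrable_fin_num mD (iu i)).
by rewrite -(integralZl mD (iu i)).
Qed.

End vector.

Context {M : nat} (p c1 c2 : R) (p_gt1 : 1 < p) (c1_gt0 : 0 < c1).
Local Notation rV := 'rV[R]_M.+1.
Variables (V : T -> rV -> R).
Hypotheses (mV : forall z, measurable_fun D (V ^~ z))
  (cV : forall x, D x -> coercive_convex p c1 c2 (V x))
  (bV : forall K, exists B, forall x z, D x -> `|z| <= K -> V x z <= B).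

Let w xi x := argmin (V x) xi.

Let mw xi i : measurable_fun D (fun x => w xi x 0 i).
Proof. by apply: (measurable_argmin mD mV _ _ _ p_gt1 c1_gt0 cV) => x /cV[]. Qed.

Let iw xi i : mu.-integrable D (EFin \o (fun x => w xi x 0 i)).
Proof.
have [K _ HK] := @argmin_bound R M p c1 c2 p_gt1 c1_gt0 `|xi|.
apply: (@integrable_bounded _ K) => // x Dx.
by rewrite (le_trans (entry_le_norm _ _))// HK//; exact: cV.
Qed.

Lemma coercive_convex_bounded (K : R) :
  exists2 B, 0 <= B & forall x z, D x -> `|z| <= K -> `|V x z| <= B.
Proof.
have [B HB] := bV K.
exists (Num.max c1 B) => [|x z Dx zK]; first by rewrite le_max ltW.
rewrite ler_norml (le_trans (HB _ _ Dx zK)) ?le_max ?lexx ?orbT// andbT.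
have [_ _ lV _] := cV Dx; apply: le_trans (lV _).
have : 0 <= c1 * `|z| `^ p by rewrite mulr_ge0 ?powR_ge0// ltW.
have : c1 <= Num.max c1 B by rewrite le_max lexx.
by rewrite mulrBr mulr1; lra.
Qed.

Let iVw xi : mu.-integrable D (EFin \o (fun x => V x (w xi x))).
Proof.
have [K _ HK] := @argmin_bound R M p c1 c2 p_gt1 c1_gt0 `|xi|.
have [B _ HB] := coercive_convex_bounded K.
apply: (@integrable_bounded _ B) => [|x Dx].
  by apply: (measurable_caratheodory_comp mD mV) => // x /cV[].
by apply: HB => //; apply: HK => //; exact: cV.
Qed.

(** The Legendre conjugate of [V x] at [xi]. *)
Let h xi x := - tilt (V x) xi (w xi x).

Let ih xi : mu.-integrable D (EFin \o h xi).
Proof.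
rewrite (_ : EFin \o _ = ((EFin \o (fun x => dot xi (w xi x))) \-
    (EFin \o (fun x => V x (w xi x))))%E).
  by apply: integrableB => //; exact: integrable_dot.
by apply/funext => x /=; rewrite /h /tilt opprB EFinB.
Qed.

Variable (m : rV).

Let Phi xi := \int[mu]_(x in D) h xi x - dot xi m.

(** This says that [vint (w xi') - m] is a subgradient of [Phi] at [xi']. It comes from testing the
    minimality of [w xi x] against [w xi' x] and integrating. *)
Let Phi_sub xi xi' : Phi xi' - Phi xi <= dot (xi' - xi) (vint (w xi') - m).
Proof.
rewrite dotDr dotNr -Rintegral_dot//.
have -> : dot (xi' - xi) m = dot xi' m - dot xi m by rewrite dotDl dotNl.
suff : \int[mu]_(x in D) h xi' x - \int[mu]_(x in D) h xi x
    <= \int[mu]_(x in D) dot (xi' - xi) (w xi' x) 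
  by rewrite /Phi; move: (Rintegral _ _ _) (Rintegral _ _ _) (Rintegral _ _ _) => *; lra.
rewrite -RintegralB//; apply: le_Rintegral => //.
- rewrite (_ : EFin \o _ = ((EFin \o h xi') \- (EFin \o h xi))%E)//.
  exact: integrableB.
- exact: integrable_dot.
- move=> x Dx; have := argminP p_gt1 c1_gt0 xi (w xi' x) (cV Dx).
  by rewrite /h /tilt dotDl dotNl -/(w xi x); lra.
Qed.

Let vw_bound (S : R) : exists2 K, 0 <= K & forall xi, `|xi| <= S -> `|vint (w xi) - m| <= K.
Proof.
have [K K0 HK] := @argmin_bound R M p c1 c2 p_gt1 c1_gt0 S.
exists (K * fine (mu D) + `|m|); first by rewrite addr_ge0// mulr_ge0// fine_ge0.
move=> xi xiS; apply: (le_trans (ler_normB _ _)); rewrite lerD2r.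
apply: norm_le_entry => i; rewrite mxE.
apply: (le_trans (le_normr_Rintegral _ _)) => //.
rewrite -Rintegral_cst//; apply: le_Rintegral => //.
- by have := integrable_norm (iw xi i).
- exact: integrable_const.
- move=> x Dx; apply: (le_trans (entry_le_norm _ _)); apply: HK => //.
  exact: cV.
Qed.

(** The subgradients are bounded on bounded sets, so [Phi] is locally Lipschitz. *)
Let Phi_continuous : continuous Phi.
Proof.
move=> xi; apply/(@cvgrPdist_le _ _ _ (nbhs xi) _ Phi (Phi xi)) => e e0.
have [K K0 HK] := vw_bound (`|xi| + 1).
pose C := M.+1%:R * K + 1.
have C0 : 0 < C by rewrite /C ltr_wpDl// mulr_ge0.
have r0 : 0 < Num.min 1 (e / C) by rewrite lt_min ltr01 divr_gt0.
apply/nbhs_ballP; exists (Num.min 1 (e / C)) => // xi'.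
rewrite -ball_normE /= lt_min => /andP[xi1 xie].
have H a b : `|a| <= `|xi| + 1 -> `|b - a| = `|xi - xi'| -> Phi a - Phi b <= e.
  move=> aS ba; apply: (le_trans (Phi_sub _ _)); apply: (le_trans (ler_norm _)).
  apply: (le_trans (dot_le _ _)); rewrite distrC ba.
  apply: (@le_trans _ _ (`|xi - xi'| * C)).
    rewrite mulrAC mulrC ler_wpM2l// /C.
    by rewrite (@le_trans _ _ (M.+1%:R * K))// ?ler_wpM2l ?HK// lerDl.
  by rewrite -ler_pdivlMr// ltW.
rewrite ler_norml; apply/andP; split; last by apply: H; [rewrite lerDl|rewrite distrC].
rewrite lerNl opprB; apply: H => //.
rewrite -[xi'](subrK xi) (le_trans (ler_normD _ _))//.
by rewrite addrC lerD2l distrC ltW.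
Qed.

Hypothesis D_gt0 : (0 < mu D)%E.

(** Testing the conjugate at the mean [m'] shifted by the unit vector along [xi] and integrating
    bounds [Phi xi] below by [mu D] times the norm of [xi] minus [B]; the contribution of [m']
    cancels [dot xi m]. *)
Let Phi_coercive : exists K, forall xi, Phi xi <= Phi 0 -> `|xi| <= K.
Proof.
have D0 : 0 < fine (mu D) by rewrite fine_gt0// D_gt0.
pose m' := (fine (mu D))^-1 *: m.
have [B HB] := bV (`|m'| + 1).
exists (Num.max 0 (B + Phi 0 / fine (mu D))) => xi xi0.
have [->|nxi0] := eqVneq xi 0; first by rewrite normr0 le_max lexx.
have xi_gt0 : 0 < `|xi| by rewrite normr_gt0.
rewrite le_max; apply/orP; right.
pose z := m' + `|xi|^-1 *: xi.
have zK : `|z| <= `|m'| + 1.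
  apply: (le_trans (ler_normD _ _)); rewrite lerD2l normrZ gtr0_norm ?invr_gt0//.
  by rewrite mulVf ?gt_eqF.
have zxi : dot xi m' + `|xi| <= dot xi z.
  rewrite dotDr lerD2l dotZr ler_pdivlMl// -expr2.
  have -> : dot xi xi = eucl_norm xi ^+ 2.
    rewrite /eucl_norm sqr_sqrtr; last by apply: sumr_ge0 => i _; exact: sqr_ge0.
    by apply: eq_bigr => i _; rewrite expr2.
  by rewrite lerXn2r ?nnegrE ?eucl_ge0// norm_le_eucl.
have : (dot xi m' + `|xi| - B) * fine (mu D) <= \int[mu]_(x in D) h xi x.
  rewrite -Rintegral_cst//; apply: le_Rintegral => //; first exact: integrable_const.
  move=> x Dx; have := argminP p_gt1 c1_gt0 xi z (cV Dx).
  by have := HB _ _ Dx zK; rewrite /h -/(w xi x) {2}/tilt; lra.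
rewrite -lerBlDl ler_pdivlMr// mulrBl.
have : dot xi m' * fine (mu D) = dot xi m.
  by rewrite /m' dotZr mulrC mulVKf ?gt_eqF.
move=> e1; rewrite mulrBl mulrDl e1 => H; move: H xi0; rewrite -/(Phi 0) [Phi xi]/Phi.
by move: (Rintegral _ _ _) (Phi 0) (dot xi m) (`|xi| * _) (B * _) => a b c e f *; lra.
Qed.

Lemma exists_multiplier : exists xi, vint (fun x => argmin (V x) xi) = m.
Proof.
have [K HK] := Phi_coercive.
have [||xi0] := @EVT_min_rV R _ Phi _ _ (@compact_norm_le R M K).
- by exists 0; apply: HK.
- exact: continuous_subspaceT.
rewrite inE => xi0K Hxi0.
have xi0P xi : Phi xi0 <= Phi xi.
  have [z0|/ltW z0] := lerP (Phi xi) (Phi 0).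
    by apply: Hxi0; rewrite inE; exact: HK.
  by apply: le_trans z0; apply: Hxi0; rewrite inE; exact: HK.
exists xi0; apply/rowP => i.
(* Minimality at [xi0] and the subgradient at [xik s k] give a one-sided bound on entry [i] of
   [vint (w (xik s k)) - m]. It survives the limit in [k], and the signs [s = 1] and [s = -1]
   together give equality. *)
pose xik (s : R) k := xi0 + k.+1%:R^-1 *: (s *: delta_mx 0 i).
have s_delta (s : R) : `|s *: (delta_mx 0 i : rV)| <= `|s|.
  rewrite normrZ ler_piMr//; apply: norm_le_entry => j.
  by rewrite mxE; case: (_ && _); rewrite ?normr1 ?normr0.
have step (s : R) k : s * m 0 i <= s * vint (w (xik s k)) 0 i.
  have k0 : 0 < k.+1%:R^-1 :> R by rewrite invr_gt0.
  have := le_trans (_ : 0 <= Phi (xik s k) - Phi xi0) (Phi_sub xi0 (xik s k)).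
  rewrite subr_ge0 => /(_ (xi0P _)).
  rewrite /xik addrAC subrr add0r dotZl pmulr_rge0// dot_delta mxE [(- m) 0 i]mxE.
  by rewrite mulrBr subr_ge0.
(* Dominated convergence: [argmin_continuous] gives the pointwise limit and [argmin_bound] a
   constant dominating function. *)
have lim (s : R) : vint (w (xik s k)) 0 i @[k --> \oo] --> vint (w xi0) 0 i.
  have [K' K'0 HK'] := @argmin_bound R M p c1 c2 p_gt1 c1_gt0 (`|xi0| + `|s|).
  rewrite mxE; under eq_fun do rewrite mxE.
  apply: fine_cvg; rewrite fineK; last exact: (integrable_fin_num mD (iw xi0 i)).
  apply: (@dominated_cvg _ _ _ _ _ mD _ _ (fun=> K'%:E)) => //.
  - by move=> k; apply/measurable_EFinP.
  - move=> x Dx; apply: cvg_EFin; first by apply: nearW.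
    apply/cvgrPdist_lt => e e0.
    have [dl dl0 Hdl] := argmin_continuous p_gt1 c1_gt0 xi0 (cV Dx) e0.
    near=> k; rewrite distrC (le_lt_trans _ (Hdl (xik s k) _))//.
      by have := entry_le_norm (w (xik s k) x - w xi0 x) i; rewrite mxE [(- w xi0 x) 0 i]mxE.
    rewrite /xik addrAC subrr add0r normrZ ger0_norm//.
    rewrite (@le_lt_trans _ _ (k.+1%:R^-1 * `|s|))//.
      by rewrite ler_wpM2l// s_delta.
    rewrite (@le_lt_trans _ _ (k.+1%:R^-1 * (`|s| + 1)))//.
      by rewrite ler_wpM2l// lerDl.
    rewrite -ltr_pdivlMr ?ltr_wpDl//; near: k.
    apply: (near_infty_natSinv_lt (PosNum (_ : 0 < dl / (`|s| + 1)))).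
    by rewrite divr_gt0// ltr_wpDl.
  - exact: integrable_const.
  - move=> k x Dx; rewrite lee_fin (le_trans (entry_le_norm _ _))// HK'//; first exact: cV.
    rewrite (le_trans (ler_normD _ _))// lerD2l normrZ.
    by rewrite (le_trans _ (s_delta s))// ler_piMl// ger0_norm// invf_le1// ler1n.
have ge (s : R) : s * m 0 i <= s * vint (w xi0) 0 i.
  apply: (@cvgr_to_ge _ \oo _ R (fun k => s * vint (w (xik s k)) 0 i)).
    by apply: cvgM; [exact: cvg_cst|exact: lim].
  by apply: nearW => k; exact: step.
apply/eqP; rewrite eq_le; apply/andP; split.
  by have := ge (-1); rewrite !mulN1r lerN2.
by have := ge 1; rewrite !mul1r.
Unshelve. all: by end_near. Qed.

End duality.

(** * Integral comparison, integrability and change of variables *)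

(** The integrals of the positive and negative parts are suprema over the simple functions below
    them, hence monotone. *)
Lemma le_integral_pointwise d (T : measurableType d) (R : realType)
    (mu : {measure set T -> \bar R}) (D : set T) (f g : T -> \bar R) :
  (forall x, D x -> (f x <= g x)%E) ->
  (\int[mu]_(x in D) f x <= \int[mu]_(x in D) g x)%E.
Proof.
move=> fg; have {}fg x : ((f \_ D) x <= (g \_ D) x)%E.
  by rewrite /patch; case: ifPn => // /[!inE]; exact: fg.
rewrite /integral; apply: leeB; apply: ereal_sup_le => _ [h /= hf <-]; exists h => // x.
  by apply: (le_trans (hf x)); rewrite !funeposE ge_max !le_max lexx orbT fg.
by apply: (le_trans (hf x)); rewrite !funenegE ge_max !le_max lexx orbT leeN2 fg.
Qed.

Lemma EFin_Rintegral d (T : measurableType d) (R : realType)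
    (mu : {measure set T -> \bar R}) (D : set T) (f : T -> R) : measurable D ->
  mu.-integrable D (EFin \o f) ->
  (\int[mu]_(x in D) (f x)%:E)%E = (\int[mu]_(x in D) f x)%:E.
Proof. by move=> mD fi; rewrite /Rintegral fineK// integrable_fin_num. Qed.

Section Lp_facts.
Context {R : realType} {n M : nat}.
Local Notation rV := 'rV[R]_M.+1.
Local Notation E := (lebesgue_type R n).
Local Notation mu := (@lebesgue_rV R n).
Variables (p : R) (p_gt1 : 1 < p) (D : set E) (mD : measurable D) (Dlty : (mu D < +oo)%E).

Lemma measurable_eucl_powR (u : E -> rV) : (forall i, measurable_fun D (fun x => u x 0 i)) ->
  measurable_fun D (fun x => eucl_norm (u x) `^ p).
Proof.
move=> mu'; apply: (measurableT_comp (f := fun r : R => r `^ p)); first exact: measurable_powR.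
apply: (measurableT_comp (f := @Num.sqrt R)).
  exact: (continuous_measurable_fun (@sqrt_continuous R)).
apply: (@measurable_sum _ _ _ D _ _ (fun i x => u x 0 i ^+ 2)) => i.
exact: measurable_funX.
Qed.

Lemma Lp_integrable (u : E -> rV) i : Lp M.+1 p D u ->
  mu.-integrable D (EFin \o (fun x => u x 0 i)).
Proof.
move=> [mu' u_lty]; have meu := measurable_eucl_powR mu'.
have ieu : mu.-integrable D (EFin \o (fun x => eucl_norm (u x) `^ p)).
  apply/integrableP; split; first exact/measurable_EFinP.
  apply: le_lt_trans u_lty; apply: le_integral_pointwise => x _ /=.
  by rewrite ger0_norm ?powR_ge0.
have i1 : mu.-integrable D (EFin \o (fun x => 1 + eucl_norm (u x) `^ p)).
  rewrite (_ : EFin \o _ = ((EFin \o (fun=> 1%R)) \+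
      (EFin \o (fun x => (eucl_norm (u x) `^ p)%R)))%E)//.
  by apply: integrableD => //; exact: integrable_const.
apply: (le_integrable mD _ _ i1).
- exact/measurable_EFinP.
- move=> x Dx /=; rewrite lee_fin [leRHS]ger0_norm ?addr_ge0 ?powR_ge0//.
  apply: (le_trans (entry_le_norm _ _)); apply: (le_trans (norm_le_eucl _)).
  have [e1|/ltW e1] := lerP (eucl_norm (u x)) 1.
    by rewrite (le_trans e1)// lerDl powR_ge0.
  by rewrite (le_trans (le1r_powR e1 (ltW p_gt1)))// lerDr.
Qed.

Lemma Lp_bounded (u : E -> rV) (K : R) : (forall i, measurable_fun D (fun x => u x 0 i)) ->
  (forall x, D x -> `|u x| <= K) -> Lp M.+1 p D u.
Proof.
move=> mu' uK; split=> //.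
apply: (@le_lt_trans _ _ (\int[mu]_(x in D) cst ((M.+1%:R * K) `^ p)%:E x)%E).
  apply: le_integral_pointwise => x Dx; rewrite lee_fin.
  have h : eucl_norm (u x) <= M.+1%:R * K.
    by rewrite (le_trans (eucl_le_norm _))// ler_wpM2l// uK.
  apply: ge0_ler_powR; rewrite ?nnegrE ?eucl_ge0 ?(le_trans (eucl_ge0 _) h)//.
  by rewrite ltW// (lt_trans _ p_gt1).
rewrite integral_cst//; apply: lte_mul_pinfty => //.
by rewrite lee_fin powR_ge0.
Qed.

End Lp_facts.

Section selfmap.
Context d (E : measurableType d) {R : realType} (mu : {measure set E -> \bar R}).
Variables (Y : set E) (T : E -> E).
Hypotheses (mY : measurable Y) (Ylty : (mu Y < +oo)%E)
  (mT : measurable_fun [set: E] T) (TY : T @^-1` Y `<=` Y)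
  (muT : forall A, measurable A -> A `<=` Y -> mu (T @^-1` A) = mu A).

Lemma measurable_selfmap (f : E -> R) : measurable_fun Y f ->
  measurable_fun Y ((f \_ Y) \o T).
Proof.
move=> mf; apply: measurable_funTS; apply: measurableT_comp => //.
exact/(measurable_restrictT f mY).
Qed.

Lemma selfmap_bounded (f : E -> R) (K : R) : 0 <= K ->
  (forall y, Y y -> `|f y| <= K) -> forall x, `|((f \_ Y) \o T) x| <= K.
Proof.
by move=> K0 fK x /=; rewrite /patch; case: ifPn => [/[!inE]/fK//|_]; rewrite normr0.
Qed.

(** Extension by zero removes the points that [T] sends out of [Y]. The pushforward by [T] agrees
    with [mu] on subsets of [Y], which is all that the integral over [Y] sees. *)
Lemma Rintegral_selfmap (f : E -> R) (K : R) : 0 <= K -> measurable_fun Y f ->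
  (forall y, Y y -> `|f y| <= K) ->
  \int[mu]_(x in Y) ((f \_ Y) \o T) x = \int[mu]_(y in Y) f y.
Proof.
move=> K0 mf fK; rewrite /Rintegral; congr fine.
have mfY : measurable_fun [set: E] (EFin \o (f \_ Y)).
  by apply/measurable_EFinP; apply/(measurable_restrictT f mY).
have mTY : measurable (T @^-1` Y) by rewrite -[X in measurable X]setTI; exact: mT.
transitivity (\int[mu]_(x in T @^-1` Y) (((EFin \o (f \_ Y)) \o T) x))%E.
  rewrite -[in RHS](setIidr TY) integral_mkcondr.
  apply: eq_integral => x _ /=; rewrite /patch /=.
  have -> : (x \in T @^-1` Y) = (T x \in Y) by apply/idP/idP; rewrite !inE.
  by case: (T x \in Y) => /=.
rewrite -integral_pushforward//; last first.
  apply: (@integrable_bounded _ _ _ _ _ _ _ (fun x => ((f \_ Y) \o T) x) K) => //.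
  - by rewrite muT.
  - apply: measurable_funTS.
    exact: (measurableT_comp (proj1 (measurable_restrictT f mY) mf) mT).
  - by move=> x _; exact: selfmap_bounded.
rewrite [LHS](eq_measure_integral mu) => [|A mA AY]; last exact: muT.
by apply: eq_integral => y /= yY; rewrite /patch yY.
Qed.

End selfmap.

(** * Minimal energies *)

Section cell_basis.
Context {R : realType} {N : nat} (v : N.+1.-tuple 'rV[R]_N.+1).

Definition basis_mx : 'M[R]_N.+1 := \matrix_i tnth v i.

Lemma mul_basis_mx (x : 'rV[R]_N.+1) : x *m basis_mx = \sum_i x 0 i *: tnth v i.
Proof. by rewrite mulmx_sum_row; apply: eq_bigr => i _; rewrite rowK. Qed.

Lemma basis_mx_unit : basis_of fullv v -> basis_mx \in unitmx.
Proof.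
move=> /basis_free/freeP vfree; rewrite -row_free_unit.
apply: inj_row_free => x; rewrite mul_basis_mx => x0; apply/rowP => i; rewrite mxE.
apply: (vfree (fun i => x 0 i)); rewrite -[RHS]x0; apply: eq_bigr => j _.
by rewrite (tnth_nth 0).
Qed.

Lemma periodicity_cellE : basis_mx \in unitmx ->
  periodicity_cell v = centred_cell basis_mx.
Proof.
move=> Pu; apply/seteqP; split=> [_ [l l12 <-] i|x xY].
  rewrite (_ : \sum_i _ = (\row_i l i) *m basis_mx) ?/cell_coord ?mulmxK ?mxE//.
  by rewrite mul_basis_mx; apply: eq_bigr => j _; rewrite mxE.
exists (fun i => cell_coord basis_mx x 0 i) => //.
by rewrite -mul_basis_mx /cell_coord mulmxKV.
Qed.

Lemma cell_periodic_lattice (M : nat) (V : 'rV[R]_N.+1 -> 'rV[R]_M -> R) x k z :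
  cell_periodic v V -> V (x + lattice_pt basis_mx k) z = V x z.
Proof.
move=> pV; rewrite /lattice_pt mul_basis_mx.
have pn (j : nat) i y : V (y + j%:R *: tnth v i) z = V y z.
  elim: j => [|j IH]; first by rewrite scale0r addr0.
  by rewrite -natr1 scalerDl scale1r addrA pV IH.
have pz (c : int) i y : V (y + c%:~R *: tnth v i) z = V y z.
  case: c => j; first exact: pn.
  by rewrite NegzE mulrNz scaleNr -[in RHS](subrK (j.+1%:R *: tnth v i) y) pn.
elim/big_rec: _ x => [|i y _ IH] x; first by rewrite addr0.
by rewrite addrA IH mxE pz.
Qed.

End cell_basis.

Section growth.
Context {R : realType} {M : nat} (p c1 c2 : R) (f : 'rV[R]_M.+1 -> R).
Hypotheses (p_gt1 : 1 < p) (c1_gt0 : 0 < c1) (c2_gt0 : 0 < c2)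
  (f_growth : forall z,
     c1 * (eucl_norm z `^ p - 1) <= f z <= c2 * (eucl_norm z `^ p + 1)).

Lemma growth_coercive_convex : continuous f -> strictly_convex f ->
  coercive_convex p c1 c2 f.
Proof.
move=> cf sf; split=> // [z|].
  have /andP[+ _] := f_growth z; apply: le_trans.
  rewrite ler_pM2l// lerD2r; apply: ge0_ler_powR; rewrite ?nnegrE ?eucl_ge0//.
    by rewrite ltW// (lt_trans _ p_gt1).
  exact: norm_le_eucl.
have /andP[_] := f_growth 0.
have -> : eucl_norm (0 : 'rV[R]_M.+1) = 0.
  by rewrite /eucl_norm big1 ?sqrtr0// => i _; rewrite mxE expr0n.
by rewrite powR0 ?add0r ?mulr1// gt_eqF// (lt_trans _ p_gt1).
Qed.

Lemma growth_bound (K : R) z : `|z| <= K -> f z <= c2 * ((M.+1%:R * K) `^ p + 1).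
Proof.
move=> zK; have /andP[_] := f_growth z; move/le_trans; apply.
have h : eucl_norm z <= M.+1%:R * K by rewrite (le_trans (eucl_le_norm _))// ler_wpM2l.
rewrite ler_pM2l// lerD2r; apply: ge0_ler_powR; rewrite ?nnegrE ?eucl_ge0//.
  by rewrite ltW// (lt_trans _ p_gt1).
exact: le_trans (eucl_ge0 _) h.
Qed.

End growth.

Section minimizers.
Context d (E : measurableType d) {R : realType} (mu : {measure set E -> \bar R}).
Context {M : nat} (p c1 c2 : R) (p_gt1 : 1 < p) (c1_gt0 : 0 < c1).
Local Notation rV := 'rV[R]_M.+1.
Variables (Y : set E) (mY : measurable Y) (Ylty : (mu Y < +oo)%E).
Variables (V : E -> rV -> R).
Hypotheses (mV : forall z, measurable_fun Y (V ^~ z))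
  (cV : forall y, Y y -> coercive_convex p c1 c2 (V y))
  (bV : forall K, exists B, forall y z, Y y -> `|z| <= K -> V y z <= B).
Variables (xi : rV).

Definition tilted_argmin y := argmin (V y) xi.
Local Notation w := tilted_argmin.

Definition min_energy := \int[mu]_(y in Y) V y (w y).

Lemma tilted_argmin_bound : exists2 K, 0 <= K & forall y, Y y -> `|w y| <= K.
Proof.
have [K K0 HK] := @argmin_bound R M p c1 c2 p_gt1 c1_gt0 `|xi|.
by exists K => // y Yy; apply: HK => //; exact: cV.
Qed.

Lemma measurable_tilted_argmin i : measurable_fun Y (fun y => w y 0 i).
Proof. by apply: (measurable_argmin mY mV _ _ _ p_gt1 c1_gt0 cV) => y /cV[]. Qed.

Lemma integrable_tilted_argmin i : mu.-integrable Y (EFin \o (fun y => w y 0 i)).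
Proof.
have [K K0 wK] := tilted_argmin_bound.
apply: (integrable_bounded mY Ylty (measurable_tilted_argmin i) (K := K)) => y Yy.
by rewrite (le_trans (entry_le_norm _ _))// wK.
Qed.

Lemma measurable_min_energy : measurable_fun Y (fun y => V y (w y)).
Proof.
apply: (measurable_caratheodory_comp mY mV) => [y /cV[]//|].
exact: measurable_tilted_argmin.
Qed.

Lemma min_energy_bound : exists2 K, 0 <= K & forall y, Y y -> `|V y (w y)| <= K.
Proof.
have [K K0 wK] := tilted_argmin_bound.
have [B B0 HB] := coercive_convex_bounded c1_gt0 cV bV K.
by exists B => // y Yy; apply: HB => //; exact: wK.
Qed.

Lemma integrable_min_energy : mu.-integrable Y (EFin \o (fun y => V y (w y))).
Proof.
have [K K0 VK] := min_energy_bound.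
exact: (integrable_bounded mY Ylty measurable_min_energy VK).
Qed.

Lemma multiplier_inequality y z : Y y -> V y (w y) + dot xi (z - w y) <= V y z.
Proof.
move=> Yy; have := argminP p_gt1 c1_gt0 xi z (cV Yy).
by rewrite /tilt dotDr dotNr -/(w y); lra.
Qed.

Lemma integrable_affine (f : E -> R) (u u' : E -> rV) :
  mu.-integrable Y (EFin \o f) ->
  (forall i, mu.-integrable Y (EFin \o (fun y => u y 0 i))) ->
  (forall i, mu.-integrable Y (EFin \o (fun y => u' y 0 i))) ->
  mu.-integrable Y (EFin \o (fun y => f y + dot xi (u y - u' y))).
Proof.
move=> fi iu iu'.
rewrite (_ : EFin \o _ = ((EFin \o f) \+ ((EFin \o (fun y => dot xi (u y))) \-
    (EFin \o (fun y => dot xi (u' y)))))%E); last first.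
  by apply/funext => y /=; rewrite dotDr dotNr.
by apply: integrableD => //; apply: integrableB => //; exact: integrable_dot.
Qed.

Lemma integral_affine (f : E -> R) (u u' : E -> rV) :
  mu.-integrable Y (EFin \o f) ->
  (forall i, mu.-integrable Y (EFin \o (fun y => u y 0 i))) ->
  (forall i, mu.-integrable Y (EFin \o (fun y => u' y 0 i))) ->
  (\int[mu]_(y in Y) (f y + dot xi (u y - u' y))%:E =
   (\int[mu]_(y in Y) f y + dot xi (vint mu Y u - vint mu Y u'))%:E)%E.
Proof.
move=> fi iu iu'; rewrite EFin_Rintegral//; last exact: integrable_affine.
congr EFin; rewrite RintegralD//; last first.
  rewrite (_ : EFin \o _ = ((EFin \o (fun y => dot xi (u y))) \-
    (EFin \o (fun y => dot xi (u' y))))%E).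
    by apply: integrableB => //; exact: integrable_dot.
  by apply/funext => y /=; rewrite dotDr dotNr.
congr (_ + _); under eq_Rintegral do rewrite dotDr dotNr.
by rewrite RintegralB//; [rewrite !Rintegral_dot// dotDr dotNr|exact: integrable_dot..].
Qed.

Variables (T : E -> E).
Hypotheses (mT : measurable_fun [set: E] T) (TY : T @^-1` Y `<=` Y)
  (muT : forall A, measurable A -> A `<=` Y -> mu (T @^-1` A) = mu A).

(** The preimage of [Y] lies in [Y] and has the same finite measure. *)
Let Y_neglig : mu.-negligible (Y `\` T @^-1` Y).
Proof.
have mTY : measurable (T @^-1` Y) by rewrite -[X in measurable X]setTI; exact: mT.
exists (Y `\` T @^-1` Y); split=> //; first exact: measurableD.
rewrite measureD// (setIidr TY).
transitivity (mu Y - mu Y)%E; first by congr (_ - _)%E; exact: muT.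
by rewrite subee// ge0_fin_numE.
Qed.

(** The rescaled periodic extension of [w], set to zero where [T] leaves [Y]. *)
Definition pullback_argmin x : rV := \row_i (((fun y => w y 0 i) \_ Y) \o T) x.

Definition pullback_energy x : R := (((fun y => V y (w y)) \_ Y) \o T) x.

Let pullback_argminE x : Y (T x) -> pullback_argmin x = w (T x).
Proof. by move=> Yx; apply/rowP => i; rewrite mxE /= /patch mem_set. Qed.

Let pullback_energyE x : Y (T x) -> pullback_energy x = V (T x) (w (T x)).
Proof. by move=> Yx; rewrite /pullback_energy /= /patch mem_set. Qed.

Lemma measurable_pullback_argmin i : measurable_fun Y (fun x => pullback_argmin x 0 i).
Proof.
under [X in measurable_fun _ X]eq_fun do rewrite mxE.
exact: measurable_selfmap (measurable_tilted_argmin i).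
Qed.

Lemma pullback_argmin_bound : exists K, forall x, `|pullback_argmin x| <= K.
Proof.
have [K K0 wK] := tilted_argmin_bound.
exists K => x; apply: norm_le_entry => i; rewrite mxE.
apply: selfmap_bounded => // y Yy.
by rewrite (le_trans (entry_le_norm _ _))// wK.
Qed.

Lemma vint_pullback_argmin : vint mu Y pullback_argmin = vint mu Y w.
Proof.
have [K K0 wK] := tilted_argmin_bound.
apply/rowP => i; rewrite !mxE; under eq_Rintegral do rewrite mxE.
apply: (Rintegral_selfmap mY Ylty mT TY muT K0 (measurable_tilted_argmin i)) => y Yy.
by rewrite (le_trans (entry_le_norm _ _))// wK.
Qed.

Let integrable_pullback_argmin i :
  mu.-integrable Y (EFin \o (fun x => pullback_argmin x 0 i)).
Proof.
have [K HK] := pullback_argmin_bound.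
apply: (integrable_bounded mY Ylty (measurable_pullback_argmin i) (K := K)) => y _.
by rewrite (le_trans (entry_le_norm _ _)).
Qed.

Let measurable_pullback_energy : measurable_fun Y pullback_energy.
Proof. exact: measurable_selfmap measurable_min_energy. Qed.

Let integrable_pullback_energy : mu.-integrable Y (EFin \o pullback_energy).
Proof.
have [K K0 VK] := min_energy_bound.
apply: (integrable_bounded mY Ylty measurable_pullback_energy (K := K)) => x _.
exact: selfmap_bounded.
Qed.

Let Rintegral_pullback_energy : \int[mu]_(x in Y) pullback_energy x = min_energy.
Proof.
have [K K0 VK] := min_energy_bound.
exact: (Rintegral_selfmap mY Ylty mT TY muT K0 measurable_min_energy).
Qed.

Variable Vn : E -> rV -> R.
Hypotheses (VnE : forall x z, Y (T x) -> Vn x z = V (T x) z)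
  (mVn : forall z, measurable_fun Y (Vn ^~ z))
  (cVn : forall x, Y x -> continuous (Vn x)).

Lemma integral_pullback_argmin :
  (\int[mu]_(x in Y) (Vn x (pullback_argmin x))%:E = min_energy%:E)%E.
Proof.
rewrite -Rintegral_pullback_energy -EFin_Rintegral//.
apply: ae_eq_integral => //.
- apply/measurable_EFinP; apply: (measurable_caratheodory_comp mY mVn) => //.
  exact: measurable_pullback_argmin.
- exact/measurable_EFinP.
- apply: negligibleS Y_neglig => x /= /not_implyP[Yx ne]; split=> // Tx; apply: ne.
  by rewrite VnE// pullback_argminE// pullback_energyE.
Qed.

Lemma le_integral_pullback (u : E -> rV) :
  (forall i, mu.-integrable Y (EFin \o (fun y => u y 0 i))) ->
  vint mu Y u = vint mu Y w ->
  (min_energy%:E <= \int[mu]_(x in Y) (Vn x (u x))%:E)%E.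
Proof.
move=> iu uw.
(* The multiplier inequality at [T x] bounds [Vn x (u x)] below by [F x], but only where [T x] lies
   in [Y]. The linear term integrates to zero because the two integrals agree. *)
pose F x := pullback_energy x + dot xi (u x - pullback_argmin x).
have iF : mu.-integrable Y (EFin \o F) by exact: integrable_affine.
have mVnu : measurable_fun Y (fun x => Vn x (u x)).
  apply: (measurable_caratheodory_comp mY mVn) => // i.
  exact/measurable_EFinP/(measurable_int mu).
have mF : measurable_fun Y F by exact/measurable_EFinP/(measurable_int mu).
have -> : (min_energy%:E = \int[mu]_(x in Y) (F x)%:E)%E.
  rewrite integral_affine// vint_pullback_argmin uw subrr dot0r addr0.
  by rewrite Rintegral_pullback_energy.
(* The minimum turns an inequality known almost everywhere into a pointwise one. *)
rewrite (@ae_eq_integral _ _ _ mu Y (fun x => (Num.min (F x) (Vn x (u x)))%:E))//.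
- by apply: le_integral_pointwise => x _; rewrite lee_fin ge_min lexx orbT.
- exact/measurable_EFinP.
- by apply/measurable_EFinP; exact: measurable_minr.
- apply: negligibleS Y_neglig => x /= /not_implyP[Yx ne]; split=> // Tx; apply: ne.
  congr EFin; apply/esym/min_idPl.
  rewrite /F pullback_energyE// pullback_argminE// VnE//.
  exact: multiplier_inequality.
Qed.

End minimizers.

(* The space dimensions N >= 1 and M >= 1 are N.+1 and M.+1. *)
Theorem theorem2p12 (R : realType) (N M : nat) (p : R) (p_gt1 : 1 < p)
  (v : N.+1.-tuple 'rV[R]_N.+1) (v_basis : basis_of fullv v)
  (Y := periodicity_cell v) (Omega := Y)
  (V : 'rV[R]_N.+1 -> 'rV[R]_M.+1 -> R)
  (V_caratheodory : caratheodory_function V)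
  (V_periodic : cell_periodic v V)
  (c1 c2 : R) (c1_gt0 : 0 < c1) (c1_lt_c2 : c1 < c2)
  (V_growth : forall x z,
     c1 * (eucl_norm z `^ p - 1) <= V x z <= c2 * (eucl_norm z `^ p + 1))
  (V_strictly_convex : forall y, Y y -> strictly_convex (V y))
  (m : 'rV[R]_M.+1)
  (admissible := [set w | Lp M.+1 p Omega w /\ vintegral Omega w = m]) :
  forall n : nat, (0 < n)%N ->
  exists c : \bar R,
    is_min_on admissible (G_eps V Omega n%:R^-1) c /\
    is_min_on admissible (G_hom V p Y Omega) c.
Proof.
move=> n n0.
have Pu := basis_mx_unit v_basis; set P := basis_mx v in Pu.
have YE : Y = centred_cell P by exact: periodicity_cellE.
clearbody Y; subst Y.
pose Y : set (lebesgue_type R N) := centred_cell P.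
rewrite -[centred_cell P]/Y in Omega V_strictly_convex admissible *.
have mY : measurable Y by exact: measurable_centred_cell.
have Ylty : (lebesgue_rV Y < +oo)%E by exact: lebesgue_centred_cell_lty.
have Y0 : (0 < lebesgue_rV Y)%E by exact: lebesgue_centred_cell_gt0.
pose a := fine (lebesgue_rV Y); have a0 : 0 < a by rewrite fine_gt0// Y0.
have aE : lebesgue_rV Y = a%:E by rewrite /a fineK// ge0_fin_numE.
have [T [mT TY nT muT]] := cell_selfmap Pu n0.
have [mV cV] := V_caratheodory.
have mVY z : measurable_fun Y (V ^~ z) by exact: measurable_funTS.
have c20 : 0 < c2 by exact: lt_trans c1_lt_c2.
have ccV y : Y y -> coercive_convex p c1 c2 (V y).
  by move=> Yy; apply: growth_coercive_convex => //; exact: V_strictly_convex.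
have bV K : exists B, forall x z, Y x -> `|z| <= K -> V x z <= B.
  exists (c2 * ((M.+1%:R * K) `^ p + 1)) => x z _.
  exact: (growth_bound p_gt1 c20 (V_growth x)).
have [xi vxi] := exists_multiplier mY Ylty p_gt1 c1_gt0 mVY ccV bV m Y0.
(* The same function as [V], with a domain type that carries the Lebesgue sigma-algebra. *)
pose W : lebesgue_type R N -> 'rV[R]_M.+1 -> R := V.
pose w := tilted_argmin W xi.
pose c := min_energy lebesgue_rV Y W xi.
have iw i := @integrable_tilted_argmin _ _ R lebesgue_rV M p c1 c2 p_gt1 c1_gt0
  Y mY Ylty W mVY ccV xi i.
have iVw := @integrable_min_energy _ _ R lebesgue_rV M p c1 c2 p_gt1 c1_gt0
  Y mY Ylty W mVY ccV bV xi.
have mw i := @measurable_tilted_argmin _ _ R M p c1 c2 p_gt1 c1_gt0 Y mY W mVY ccV xi i.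
have [K K0 wK] := @tilted_argmin_bound _ _ R M p c1 c2 p_gt1 c1_gt0 Y W ccV xi.
have icst (z : 'rV[R]_M.+1) i : (@lebesgue_rV R N).-integrable Y (EFin \o (fun=> z 0 i)).
  exact: integrable_const.
have vcst (z : 'rV[R]_M.+1) : vintegral Y (fun=> z) = a *: z.
  by apply/rowP => i; rewrite !mxE Rintegral_cst// mulrC.
have Lpcst (z : 'rV[R]_M.+1) : Lp M.+1 p Y (fun=> z).
  by apply: (Lp_bounded p_gt1 mY Ylty (K := `|z|)).
pose z0 := a^-1 *: m.
(* For each competitor [phi], the multiplier inequality is integrated at [z + phi y], whose integral
   is [a *: z] because [phi] has mean zero. *)
have V_hom_ge z : ((a^-1 * c + dot xi (z - z0))%:E <= V_hom V p Y z)%E.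
  apply: le_ereal_inf_tmp => _ [phi [Lphi phi0] <-].
  have iphi i := Lp_integrable p_gt1 mY Ylty i Lphi.
  have iz i : (@lebesgue_rV R N).-integrable Y (EFin \o (fun x => (z + phi x) 0 i)).
    rewrite (_ : EFin \o _ = ((EFin \o (fun=> z 0%R i)) \+
        (EFin \o (fun x => phi x 0%R i)))%E).
      exact: integrableD.
    by apply/funext => x /=; rewrite mxE.
  have vz : vint lebesgue_rV Y (fun x => z + phi x) = a *: z.
    transitivity (vintegral Y (fun=> z) + vintegral Y phi); last by rewrite phi0 addr0.
    apply/rowP => i; rewrite !mxE.
    under eq_Rintegral do rewrite mxE.
    exact: (RintegralD mY (icst z i) (iphi i)).
  have := integral_affine mY xi iVw iz iw.
  rewrite vz vxi -/c => E1.
  rewrite -/a (_ : a^-1 * c + _ = a^-1 * (c + dot xi (a *: z - m))); last first.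
    by rewrite mulrDr /z0 !dotDr !dotNr !dotZr; field; rewrite gt_eqF.
  rewrite EFinM; apply: lee_wpmul2l; first by rewrite lee_fin invr_ge0 ltW.
  rewrite -E1; apply: le_integral_pointwise => y Yy.
  rewrite convex_envelope_convex ?lee_fin; last exact: V_strictly_convex.
  exact: (@multiplier_inequality _ _ R M p c1 c2 p_gt1 c1_gt0 Y W ccV).
have V_hom_z0 : V_hom V p Y z0 = (a^-1 * c)%:E.
  apply/eqP; rewrite eq_le; apply/andP; split; last first.
    by have := V_hom_ge z0; rewrite subrr dot0r addr0.
  (* The optimal fluctuation: adding [z0] gives back [w], and its mean is zero since [w] has
     integral [m]. *)
  apply: ereal_inf_lbound; exists (fun y => w y - z0).
    split.
      apply: (Lp_bounded p_gt1 mY Ylty (K := K + `|z0|)) => [i|y Yy].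
        under [X in measurable_fun _ X]eq_fun do rewrite mxE [(- z0) 0 i]mxE.
        by apply: measurable_funB.
      by rewrite (le_trans (ler_normB _ _))// lerD2r wK.
    have := vcst z0; rewrite /z0 scalerA mulfV ?gt_eqF// scale1r -/z0 => E1.
    apply/rowP => i; rewrite !mxE; under eq_Rintegral do rewrite mxE [(- z0) 0 i]mxE.
    rewrite RintegralB//.
    move/rowP/(_ i): vxi; rewrite mxE => ->.
    by move/rowP/(_ i): E1; rewrite mxE => ->; rewrite subrr.
  rewrite -/a EFinM; congr (_ * _)%E.
  rewrite /c /min_energy -EFin_Rintegral//; apply: eq_integral => y /[!inE] Yy.
  rewrite (_ : z0 + (w y - z0) = w y); last by rewrite addrC subrK.
  by rewrite convex_envelope_convex//; exact: V_strictly_convex.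
pose Vn (x : lebesgue_type R N) := V (n%:R *: (x : 'rV[R]_N.+1)).
have VnE x z : Y (T x) -> Vn x z = W (T x) z.
  by move=> /nT[k]; rewrite /Vn => ->; exact: cell_periodic_lattice.
have mVn z : measurable_fun Y (Vn ^~ z).
  apply: measurable_funTS => _ B mB; rewrite setTI.
  have mA : measurable ((V ^~ z) @^-1` B : set (lebesgue_type R N)).
    by rewrite -[X in measurable X]setTI; exact: mV.
  have := measurable_affine 0 (_ : 0 < n%:R) mA; rewrite ltr0n => /(_ n0).
  by congr (measurable _); apply/seteqP; split=> x /=; rewrite addr0.
have cVn x : Y x -> continuous (Vn x) by move=> _; exact: cV.
exists c%:E; split; split.
- exists (pullback_argmin Y W xi T).
    have [K' HK'] := @pullback_argmin_bound _ _ R M p c1 c2 p_gt1 c1_gt0 Y W ccV xi T.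
    split.
      apply: (Lp_bounded p_gt1 mY Ylty (K := K')) => [i|x _]; last exact: HK'.
      exact: (@measurable_pullback_argmin _ _ R M p c1 c2 p_gt1 c1_gt0 Y mY W mVY ccV).
    exact: etrans (@vint_pullback_argmin _ _ R lebesgue_rV M p c1 c2 p_gt1 c1_gt0 Y
      mY Ylty W mVY ccV xi T mT TY muT) vxi.
  rewrite /G_eps invrK.
  exact: (@integral_pullback_argmin _ _ R lebesgue_rV M p c1 c2 p_gt1 c1_gt0 Y mY Ylty W
    mVY ccV bV xi T mT TY muT Vn VnE mVn cVn).
- move=> u [Lu vu]; rewrite /G_eps invrK.
  apply: (@le_integral_pullback _ _ R lebesgue_rV M p c1 c2 p_gt1 c1_gt0 Y mY Ylty W
    mVY ccV bV xi T mT TY muT Vn VnE mVn cVn).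
    by move=> i; exact: (Lp_integrable p_gt1 mY Ylty i Lu).
  exact: etrans vu (esym vxi).
- exists (fun=> z0); first by split; rewrite ?vcst ?scalerA ?mulfV ?gt_eqF ?scale1r.
  rewrite /G_hom; under eq_integral do rewrite V_hom_z0.
  rewrite integral_cst// [X in (_ * X)%E](_ : _ = a%:E)// -EFinM; congr EFin.
  by rewrite mulrAC mulVf ?gt_eqF// mul1r.
- move=> u [Lu vu]; have iu i := Lp_integrable p_gt1 mY Ylty i Lu.
  (* The integral of the affine minorant depends on [u] only through its integral [m], for which the
     linear term vanishes. *)
  apply: (@le_trans _ _
    (\int[lebesgue_rV]_(x in Y) (a^-1 * c + dot xi (u x - z0))%:E)%E); last first.
    by apply: le_integral_pointwise => x _; exact: V_hom_ge.
  rewrite (integral_affine mY xi (integrable_const mY Ylty (a^-1 * c)) iu (icst z0)).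
  rewrite [vint _ _ u]vu [vint _ _ (fun=> z0)]vcst scalerA mulfV ?gt_eqF// scale1r.
  rewrite subrr dot0r addr0 Rintegral_cst// lee_fin -/a.
  by rewrite mulrAC mulVf ?gt_eqF// mul1r.
Qed.
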